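(* In the two-sample location setting described in the context (including its standing assumption on $k$ and $h$), assume that the derivative $f^{(1)}$ of $f$ exists and is continuous in a neighborhood of both $0$ and $\theta$. Then the Pitman efficiencies of the smoothed Wilcoxon rank sum statistic $\widetilde W_2$ and of the Wilcoxon rank sum statistic $W_2$ coincide: $$e_P[\widetilde{W}_2] = e_P[W_2].$$
   Context: Setting: $X_1,\dots,X_m$ are i.i.d. from a distribution function $F$ with density $f$, and, independently, $Y_1,\dots,Y_n$ are i.i.d. from $F(x-\theta)$, where $\theta$ is an unknown location parameter; the null hypothesis is $H_0:\theta=0$ and the alternative is $H_1:\theta>0$. Put $N=m+n$ and $\lambda_N=m/N\to\lambda$ with $0<\lambda<1$; limits are as $N\to\infty$. $E_\theta, V_\theta$ denote expectation and variance when the shift is $\theta$; $E_0,V_0$ those under $H_0$. Wilcoxon rank sum statistic: $W_2=\sum_{i=1}^m\sum_{j=1}^n\psi(Y_j-X_i)$, where $\psi(x)=1$ for $x\ge0$ and $\psi(x)=0$ for $x<0$. Smoothed Wilcoxon statistic: $\widetilde{W}_2=\sum_{i=1}^{m}\sum_{j=1}^n K\left(\frac{Y_j-X_i}{h}\right)$, where $K(t)=\int_{-\infty}^t k(u)\,du$, the kernel $k$ is symmetric about the origin with $\int_{-\infty}^\infty k(t)\,dt=1$, and $h=h_N>0$ is a bandwidth with $h\to0$. Write $A_{i,j}=\int_{-\infty}^\infty t^i\,\{k(t)\}^j\,dt$. Standing assumption: $h=o(N^{-1/2})$, or $A_{1,1}=A_{2,1}=A_{3,1}=0$ and $h=o(N^{-1/4})$.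 Pitman efficiency of a statistic $T$: $e_P[T]=\lim_{N\to\infty}\left[(N V_0[T])^{-1/2}\,\frac{\partial}{\partial\theta}E_\theta[T]\big|_{\theta=0}\right]$.
   Formalization: The equality is stated assuming that e_P[W_2] exists as a finite limit (shown to hold if the integral of f^2 is finite); continuity of f^{(1)} near 0 and θ alone does not ensure this, e.g. when f has a singularity |x-5|^{-3/4}. *)

(* Defs.v *)
From HB Require Import structures.
From mathcomp Require Export all_boot all_order all_algebra.
From mathcomp Require Export all_classical all_reals all_analysis.

Set Implicit Arguments.
Unset Strict Implicit.
Unset Printing Implicit Defensive.

Export Order.TTheory GRing.Theory Num.Theory.
Export numFieldNormedType.Exports.

Local Open Scope classical_set_scope.
Local Open Scope ring_scope.

Definition mutually_independent (d : measure_display) (T : measurableType d)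
    (R : realType) (P : probability T R) (I : eqType)
    (Z : I -> {mfun T >-> R}) : Prop :=
  forall (s : seq I) (A : I -> set R),
    uniq s -> (forall i, measurable (A i)) ->
    P (\big[setI/setT]_(i <- s) (Z i @^-1` A i)) =
    (\prod_(i <- s) P (Z i @^-1` A i))%E.

Definition has_density (R : realType) (F f : R -> R) : Prop :=
  [/\ measurable_fun setT f, (forall x, 0 <= f x) &
      forall x, (F x)%:E = (\int[lebesgue_measure]_(t in `]-oo, x]) (f t)%:E)%E].

Definition C1_near (R : realType) (f : R -> R) (a : R) : Prop :=
  \forall x \near a, derivable f x 1 /\ {for x, continuous (derive1 f)}.

Section TwoSample.
Context (d : measure_display) (Omega : measurableType d) (R : realType).

Definition pooled (X Y : nat -> {mfun Omega >-> R}) (i : nat + nat) :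
    {mfun Omega >-> R} :=
  match i with inl i => X i | inr j => Y j end.

(* P t is the law of the experiment when the shift is t; the samples of size
   m and n are the first m terms of X and the first n terms of Y. *)
Definition two_sample_location (P : R -> probability Omega R)
    (X Y : nat -> {mfun Omega >-> R}) (F : R -> R) : Prop :=
  forall t : R,
    [/\ mutually_independent (P t) (pooled X Y),
        (forall i x, cdf (X i : {RV (P t) >-> R}) x = (F x)%:E) &
        forall j x, cdf (Y j : {RV (P t) >-> R}) x = (F (x - t))%:E].

(* In `fine` below nothing is lost for a statistic that is square integrable
   under every P t, as bounded statistics are. *)
Definition mean (P : R -> probability Omega R) (T : Omega -> R) (t : R) : R :=
  fine 'E_(P t)[T].

Definition null_variance (P : R -> probability Omega R) (T : Omega -> R) : R :=
  fine 'V_(P 0)[T].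

Definition pitman_seq (P : R -> probability Omega R) (T : nat -> Omega -> R)
    (N : nat) : R :=
  (N%:R * null_variance P (T N)) `^ (- 2^-1) * derive1 (mean P (T N)) 0.

Definition pitman_efficiency (P : R -> probability Omega R)
    (T : nat -> Omega -> R) : R :=
  lim (pitman_seq P T @ \oo).

(* `lim` and the derivative are total functions: this predicate says that
   pitman_efficiency is the limit of genuine derivatives. *)
Definition has_pitman_efficiency (P : R -> probability Omega R)
    (T : nat -> Omega -> R) : Prop :=
  (\forall N \near \oo, derivable (mean P (T N)) 0 1) /\
  cvg (pitman_seq P T @ \oo).

Definition psi (x : R) : R := if 0 <= x then 1 else 0.

Definition wilcoxon (X Y : nat -> {mfun Omega >-> R}) (m n : nat)
    (w : Omega) : R :=
  \sum_(i < m) \sum_(j < n) psi (Y j w - X i w).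

Definition kernel_cdf (k : R -> R) (t : R) : R :=
  \int[lebesgue_measure]_(u in `]-oo, t]) k u.

Definition smoothed_wilcoxon (X Y : nat -> {mfun Omega >-> R}) (k : R -> R)
    (h : R) (m n : nat) (w : Omega) : R :=
  \sum_(i < m) \sum_(j < n) kernel_cdf k ((Y j w - X i w) / h).

End TwoSample.

(* Kernels may take negative values: a kernel with vanishing second moment
   has to. *)
Definition symmetric_kernel (R : realType) (k : R -> R) : Prop :=
  [/\ lebesgue_measure.-integrable setT (EFin \o k),
      (forall t, k (- t) = k t) &
      \int[lebesgue_measure]_t k t = 1].

Definition kernel_moment (R : realType) (k : R -> R) (i j : nat) : R :=
  \int[lebesgue_measure]_t (t ^+ i * k t ^+ j).

(* Integrability is required separately, since the integral of a function that
   is not integrable may be 0 by convention. *)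
Definition vanishing_moment (R : realType) (k : R -> R) (i : nat) : Prop :=
  lebesgue_measure.-integrable setT (EFin \o (fun t : R => t ^+ i * k t ^+ 1))
  /\ kernel_moment k i 1 = 0.

Definition bandwidth_condition (R : realType) (k : R -> R) (h : nat -> R) :
    Prop :=
  h =o_\oo (fun N : nat => (N%:R : R) `^ (- 2^-1)) \/
  [/\ vanishing_moment k 1, vanishing_moment k 2, vanishing_moment k 3 &
      h =o_\oo (fun N : nat => (N%:R : R) `^ (- 4^-1))].

(* Main.v *)
From HB Require Import structures.
Require Import Defs.
From mathcomp Require Import measurable_realfun lra ring.

Set Implicit Arguments.
Unset Strict Implicit.
Unset Printing Implicit Defensive.

Local Open Scope classical_set_scope.
Local Open Scope ring_scope.

(** Both statistics are sums over all pairs of [phi (Y_j - X_i)], the Wilcoxon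
    statistic with [phi = psi] and the smoothed one with [phi = K (. / h)].
    Write [S t] for the probability of [Y_0 - X_0 + t >= 0] when the shift is
    0; it is the integral of [f x * F (x + t)], [difference_cdf f] below.
    Formally [S' t] is the autocorrelation [g t], the integral of
    [f x * f (x + t)].  The common efficiency is
    [V ^ (-1/2) * lambda (1 - lambda) * g 0], where [V] is the limit of the
    null variance of either statistic divided by [N ^ 3].  Three facts
    establish this.

    The variance.  Under the null law all observations are exchangeable, so
    the covariance of two summands depends only on which indices they share.
    The variance is [m n] times a combination of three covariances
    ([null_variance_pair_statistic]); the two that survive division by [N ^ 3]
    belong to pairs sharing one observation.  Since [K (z / h) --> psi z] for
    [z != 0] and ties have probability 0, dominated convergence gives the same
    limits for both statistics ([covariances_cvg]).  The limits are positive
    because, of three exchangeable observations, each is the smallest (or the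
    largest) with probability at least 1/3, which exceeds the square of 1/2
    ([cov_first_psi_gt0], [cov_second_psi_gt0]).

    The mean.  When the shift is [t] the mean of the Wilcoxon statistic is
    [m n S t], and by Fubini that of the smoothed one is [m n] times the
    integral of [k u * S (t - h u)] ([integral_kernel_cdf]).  If [f ^ 2] is
    integrable, [S] is differentiable with the bounded continuous derivative
    [g] ([derivable_difference_cdf]), so the derivatives at 0 are [m n * g 0]
    and [m n] times the integral of [k u * g (- h u)]; the latter integral tends
    to [g 0] with [h], by dominated convergence ([smoothed_derivative_cvg]).

    Integrability of [f ^ 2].  If the Wilcoxon statistic has an efficiency, [S]
    is differentiable at 0.  As [F' = f] almost everywhere, Fatou's lemma
    applied to [f x * (F (x + t) - F x) / t] bounds the integral of [f ^ 2] by
    [S' 0] ([sqr_integral_le_limn_einf]).  The same inequality shows that the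
    averages of [g] over [[0, t]] tend to [g 0]; a subadditivity property of
    [g 0 - g] turns this into continuity of [g] ([continuous_autocorrelation]). *)

(** * Derivatives as limits, translation invariance *)
Section DerivativeAsLimit.
Context (R : realType).

Lemma derivable_derive1P (phi : R -> R) (a l : R) :
  (derivable phi a 1 /\ derive1 phi a = l) <->
  h^-1 *: (phi (h + a) - phi a) @[h --> 0^'] --> l.
Proof.
split=> [[+ <-]|dl].
  by rewrite /derivable; under eq_fun do rewrite /= scaler1.
split; last by apply/cvg_lim; [exact: Rhausdorff|].
by apply/cvg_ex; exists l; under eq_fun do rewrite /= scaler1.
Qed.

End DerivativeAsLimit.

Section Translation.
Context (R : realType).
Notation lambda := (@lebesgue_measure R).

Lemma ge0_integral_translation (c : R) (G : R -> \bar R) :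
  measurable_fun setT G -> (forall x, 0 <= G x)%E ->
  (\int[lambda]_x G (x + c)%R = \int[lambda]_x G x)%E.
Proof.
move=> mG G0.
have mc : measurable_fun setT (fun x : R => x + c) by exact: measurable_funD.
pose s : measurableTypeR R -> measurableTypeR R := fun x : R => x + c.
pose m' : {measure set (measurableTypeR R) -> \bar R} := pushforward lambda s.
have E A : measurable A -> lambda A = m' mc A.
  apply: lebesgue_measure_unique => _ [[a b] /= _ <-].
  rewrite /pushforward (_ : _ @^-1` _ = `]a - c, b - c]%classic); last first.
    by apply/seteqP; split => x /=; rewrite !in_itv/= ltrBlDr lerBrDr.
  by rewrite !lebesgue_measure_itv/= !lte_fin ltrD2r -!EFinB opprB addrA subrK.
rewrite -[LHS](@ge0_integral_pushforward _ _ _ _ R s mc lambda setT G)//.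
by apply: eq_measure_integral => A mA _; exact/esym/E.
Qed.

End Translation.

(** * The distribution function of the difference of two observations *)
Section Increments.
Context (R : realType) (f : R -> R).
Notation lambda := (@lebesgue_measure R).
Hypothesis mf : measurable_fun setT f.
Hypothesis f_ge0 : forall x, 0 <= f x.
Hypothesis intf : lambda.-integrable setT (EFin \o f).

Definition primitive (x : R) : R := \int[lambda]_(t in `]-oo, x]) f t.

Definition autocorrelation (z : R) : R := \int[lambda]_x (f x * f (x + z)).

(** When [f] is the density of independent [X] and [Y], this is the probability
    of [X <= Y + t]. *)
Definition difference_cdf (t : R) : R :=
  \int[lambda]_x (f x * primitive (x + t)).

Lemma primitiveE x :
  (primitive x)%:E = (\int[lambda]_(t in `]-oo, x]) (f t)%:E)%E.
Proof.
rewrite fineK//; apply: integrable_fin_num => //.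
exact: integrableS intf.
Qed.

Lemma primitive_ge0 x : 0 <= primitive x.
Proof. by apply: Rintegral_ge0 => t _; exact: f_ge0. Qed.

Lemma primitive_le x : primitive x <= \int[lambda]_t f t.
Proof.
rewrite -lee_fin primitiveE [leRHS]fineK; last exact: integrable_fin_num.
apply: ge0_subset_integral => //.
  exact/measurable_EFinP.
by move=> t _; rewrite lee_fin.
Qed.

Lemma primitiveD c t : 0 <= t ->
  (primitive (c + t))%:E =
  ((primitive c)%:E + \int[lambda]_(s in `]0%R, t]) (f (c + s))%:E)%E.
Proof.
move=> t0; rewrite !primitiveE.
have -> : (\int[lambda]_(s in `]0%R, t]) (f (c + s))%:E =
           \int[lambda]_(s in `]c, (c + t)%R]) (f s)%:E)%E.
  rewrite integral_mkcond [RHS]integral_mkcond.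
  rewrite -[RHS](ge0_integral_translation c).
  - apply: eq_integral => s _; rewrite !patchE [in RHS]/=.
    by rewrite !mem_setE !in_itv/= ltrDr [(c + t)%R]addrC lerD2r [(c + s)%R]addrC.
  - by apply/(measurable_restrictT _ _).1 => //; exact/measurable_funTS/measurable_EFinP.
  - by move=> x; rewrite patchE; case: ifPn => // _; rewrite lee_fin.
rewrite -ge0_integral_setU//=.
- by rewrite -itv_bndbnd_setU//= bnd_simp ?lerDl.
- exact/measurable_funTS/measurable_EFinP.
- by move=> x _; rewrite lee_fin.
- apply/disj_setPLR => x /=; rewrite !in_itv/= => xc /andP[cx _].
  by rewrite leNgt cx in xc.
Qed.

Lemma primitive_nondecreasing : {homo primitive : x y / x <= y}.
Proof.
move=> x y xy; rewrite -lee_fin -(subrK x y) addrC primitiveD ?subr_ge0//.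
by rewrite leeDl// integral_ge0// => s _; rewrite lee_fin.
Qed.

Lemma measurable_primitive : measurable_fun setT primitive.
Proof. exact: nondecreasing_measurable primitive_nondecreasing. Qed.

End Increments.

Section FatouBound.
Context (R : realType) (f : R -> R).
Notation lambda := (@lebesgue_measure R).
Hypothesis mf : measurable_fun setT f.
Hypothesis f_ge0 : forall x, 0 <= f x.
Hypothesis intf : lambda.-integrable setT (EFin \o f).
Local Notation primitive := (primitive f).
Local Notation difference_cdf := (difference_cdf f).

Lemma integrable_mul_primitive t :
  lambda.-integrable setT (EFin \o (fun x => f x * primitive (x + t))).
Proof.
have -> : EFin \o (fun x => f x * primitive (x + t)) =
    ((EFin \o f) \* (EFin \o (fun x => primitive (x + t))))%E.
  by apply/funext => x /=; rewrite EFinM.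
apply: integrableMl => //.
  apply: measurableT_comp; first exact: measurable_primitive.
  exact: measurable_funD.
exists (\int[lambda]_t f t); split; first exact: num_real.
move=> M /ltW BM x _ /=; rewrite ger0_norm ?primitive_ge0//.
exact: (le_trans (primitive_le _ _ _ _)).
Qed.

Lemma difference_cdfB s t :
  ((difference_cdf s - difference_cdf t)%:E =
   \int[lambda]_x (f x * (primitive (x + s) - primitive (x + t)))%:E)%E.
Proof.
rewrite -RintegralB//; [|exact: integrable_mul_primitive..].
rewrite fineK.
  by apply: eq_integral => x _; rewrite mulrBr.
under eq_fun do rewrite EFinB.
apply: integrable_fin_num => //.
by apply: integrableB => //; exact: integrable_mul_primitive.
Qed.

Lemma ae_derivable_primitive :
  {ae lambda, forall x, derivable primitive x 1 /\ derive1 primitive x = f x}.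
Proof.
apply: FTC1Ny; last exact: open_integrable_locally openT intf.
by move=> y; exact: integrableS intf.
Qed.

(** Fatou's lemma for the nonnegative functions
    [f x * (F (x + t) - F x) / t], whose pointwise limit is [f x ^ 2] almost
    everywhere by Lebesgue differentiation, and whose integrals are difference
    quotients of [difference_cdf f] at 0.  It serves both to deduce that [f ^ 2]
    is integrable and to identify the derivative. *)
Lemma sqr_integral_le_limn_einf (t : R^nat) :
  (forall n, 0 < t n) -> t @ \oo --> 0 ->
  (\int[lambda]_x (f x ^+ 2)%:E <=
   limn_einf (fun n => ((difference_cdf (t n) - difference_cdf 0) / t n)%:E))%E.
Proof.
move=> t_gt0 t_cvg0.
pose u n x := (f x * ((primitive (x + t n) - primitive (x + 0)) / t n))%:E.
have mu n : measurable_fun setT (u n).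
  apply/measurable_EFinP; apply: measurable_funM => //.
  apply: measurable_funM => //; apply: measurable_funB;
    (apply: measurableT_comp; first exact: measurable_primitive);
    exact: measurable_funD.
have u0 n x : (0 <= u n x)%E.
  rewrite lee_fin mulr_ge0// divr_ge0//; last exact: ltW.
  rewrite subr_ge0.
  by apply: primitive_nondecreasing => //; rewrite lerD2l ltW.
have uE n : (\int[lambda]_x u n x =
    ((difference_cdf (t n) - difference_cdf 0) / t n)%:E)%E.
  rewrite EFinM difference_cdfB muleC -ge0_integralZl//=.
  - by apply: eq_integral => x _; rewrite -EFinM mulrCA [_^-1 * _]mulrC.
  - apply/measurable_EFinP; apply: measurable_funM => //; apply: measurable_funB;
    (apply: measurableT_comp; first exact: measurable_primitive);
    exact: measurable_funD.
  - move=> x _; rewrite lee_fin mulr_ge0// subr_ge0.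
    by apply: primitive_nondecreasing => //; rewrite lerD2l ltW.
  - by rewrite lee_fin invr_ge0 ltW.
under [X in (_ <= limn_einf X)%E]eq_fun do rewrite -uE.
apply: le_trans (fatou lambda measurableT mu (fun n x _ => u0 n x)).
apply: ae_ge0_le_integral => //.
- by move=> x _; rewrite lee_fin sqr_ge0.
- exact/measurable_EFinP/measurable_funX.
- move=> x _; rewrite limn_einf_lim; apply: lime_ge; first exact: is_cvg_einfs.
  by apply: nearW => n; apply: le_ereal_inf_tmp => _ [m _ <-]; exact: u0.
- rewrite /limn_einf; apply/measurableT_comp => //.
  by apply: measurable_fun_limn_esup => n; apply: measurableT_comp => //; exact: mu.
- have := ae_derivable_primitive.
  apply: filterS; first exact: (ae_filter_ringOfSetsType lambda).
  move=> x [dx dE] _.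
  suff ux : u ^~ x @ \oo --> (f x ^+ 2)%:E by rewrite (cvg_limn_einf_sup ux).
  apply/fine_cvgP; split; first exact: nearW.
  rewrite expr2; apply: cvgM; first exact: cvg_cst.
  have /derivable_derive1P/cvgr_dnbhsP/(_ t) ux := conj dx dE.
  apply: cvg_trans (ux _); last by split=> // n; exact: lt0r_neq0.
  apply: near_eq_cvg; apply: nearW => n /=.
  by rewrite addr0 [x + t n]addrC [RHS]mulrC.
Qed.
End FatouBound.

(** * The autocorrelation of a square-integrable density *)
Section SquareIntegrable.
Context (R : realType) (f : R -> R).
Notation lambda := (@lebesgue_measure R).
Hypothesis mf : measurable_fun setT f.
Hypothesis f_ge0 : forall x, 0 <= f x.
Hypothesis sqf : lambda.-integrable setT (EFin \o (fun x : R => f x ^+ 2)).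
Local Notation g := (autocorrelation f).

Lemma measurable_translate a : measurable_fun setT (fun x : R => f (x + a)).
Proof. by apply: measurableT_comp => //; exact: measurable_funD. Qed.

Lemma integrable_sqr_translate a :
  lambda.-integrable setT (EFin \o (fun x : R => f (x + a) ^+ 2)).
Proof.
apply/integrableP; split.
  by apply/measurable_EFinP/measurable_funX; exact: measurable_translate.
rewrite [ltLHS](ge0_integral_translation a (G := fun x : R => `|(f x ^+ 2)%:E|%E)).
- by have /integrableP[] := sqf.
- by apply/measurableT_comp => //; exact/measurable_EFinP/measurable_funX.
- by move=> x; exact: abse_ge0.
Qed.

Lemma integrable_mul_translates a b :
  lambda.-integrable setT (EFin \o (fun x : R => f (x + a) * f (x + b))).
Proof.
apply: (@le_integrable _ _ _ lambda setT measurableT _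
  (fun x : R => (f (x + a) ^+ 2)%:E + (f (x + b) ^+ 2)%:E)%E) => //.
- by apply/measurable_EFinP/measurable_funM; exact: measurable_translate.
- move=> x _ /=; rewrite lee_fin !ger0_norm ?addr_ge0 ?mulr_ge0 ?sqr_ge0//.
  have := f_ge0 (x + a); have := f_ge0 (x + b); nra.
- by apply: integrableD => //; exact: integrable_sqr_translate.
Qed.

Lemma integral_mul_translates a b :
  \int[lambda]_x (f (x + a) * f (x + b)) = g (b - a).
Proof.
rewrite /autocorrelation /Rintegral; congr fine.
rewrite -(ge0_integral_translation a (G := fun x : R => (f x * f (x + (b - a)))%:E)).
- by apply: eq_integral => x _; rewrite -addrA subrKC.
- apply/measurable_EFinP/measurable_funM => //; exact: measurable_translate.
- by move=> x; rewrite lee_fin mulr_ge0.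
Qed.

Lemma integrable_mul_translate a :
  lambda.-integrable setT (EFin \o (fun x : R => f x * f (x + a))).
Proof.
by have := integrable_mul_translates 0 a; under eq_fun do rewrite addr0.
Qed.

Lemma autocorrelation0 : g 0 = \int[lambda]_x (f x ^+ 2).
Proof. by apply: eq_Rintegral => x _; rewrite addr0 expr2. Qed.

Lemma autocorrelation_ge0 z : 0 <= g z.
Proof. by apply: Rintegral_ge0 => x _; rewrite mulr_ge0. Qed.

Lemma autocorrelationN z : g (- z) = g z.
Proof.
rewrite -[in LHS]sub0r -integral_mul_translates.
by apply: eq_Rintegral => x _; rewrite addr0 mulrC.
Qed.

Lemma integrable_sqr_increment a b :
  lambda.-integrable setT (EFin \o (fun x : R => (f (x + a) - f (x + b)) ^+ 2)).
Proof.
have -> : EFin \o (fun x : R => (f (x + a) - f (x + b)) ^+ 2) =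
  (fun x : R => ((f (x + a) ^+ 2)%:E + (f (x + b) ^+ 2)%:E)
   - ((f (x + a) * f (x + b))%:E + (f (x + a) * f (x + b))%:E))%E.
  by apply/funext => x /=; congr EFin; ring.
apply: integrableB => //; apply: integrableD => //;
  solve [exact: integrable_sqr_translate | exact: integrable_mul_translates].
Qed.

(** Expanding the square: [g 0 - g z] is half the squared L2 distance between
    [f] and its translate by [z], whence the bounds and the subadditivity
    below. *)
Lemma integral_sqr_increment a b :
  \int[lambda]_x (f (x + a) - f (x + b)) ^+ 2 = 2 * (g 0 - g (b - a)).
Proof.
have E x : (f (x + a) - f (x + b)) ^+ 2 =
  (f (x + a) * f (x + a) + f (x + b) * f (x + b)) -
  (f (x + a) * f (x + b) + f (x + a) * f (x + b)) by ring.
under eq_Rintegral do rewrite E.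
have I c d := integrable_mul_translates c d.
rewrite RintegralB// ?RintegralD// ?integral_mul_translates ?subrr; first ring.
- rewrite /comp; under eq_fun do rewrite EFinD; apply: integrableD => //; exact: I.
- rewrite /comp; under eq_fun do rewrite EFinD; apply: integrableD => //; exact: I.
Qed.

Lemma autocorrelation_le z : g z <= g 0.
Proof.
have : 0 <= 2 * (g 0 - g (z - 0)).
  by rewrite -integral_sqr_increment Rintegral_ge0// => x _; exact: sqr_ge0.
by rewrite subr0 pmulr_rge0// subr_ge0.
Qed.

(** The triangle inequality for L2 distances between translates, in the squared
    form [(u - w) ^ 2 <= 2 (u - v) ^ 2 + 2 (v - w) ^ 2]. *)
Lemma autocorrelation_defect a b :
  g 0 - g (a + b) <= 2 * (g 0 - g a) + 2 * (g 0 - g b).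
Proof.
have Ea := integral_sqr_increment 0 a.
have Eb := integral_sqr_increment a (a + b).
have Eab := integral_sqr_increment 0 (a + b).
rewrite !subr0 in Ea Eab; rewrite [a + b - a]addrAC subrr add0r in Eb.
suff : 2 * (g 0 - g (a + b)) <= 2 * (2 * (g 0 - g a)) + 2 * (2 * (g 0 - g b)).
  lra.
rewrite -Ea -Eb -Eab -!RintegralZl//; try exact: integrable_sqr_increment.
have I c d : lambda.-integrable setT
    (EFin \o (fun x : R => 2 * (f (x + c) - f (x + d)) ^+ 2)).
  rewrite /comp; under eq_fun do rewrite EFinM.
  by apply: integrableZl => //; exact: integrable_sqr_increment.
rewrite -RintegralD//; apply: le_Rintegral => //.
- exact: integrable_sqr_increment.
- rewrite /comp; under eq_fun do rewrite EFinD; apply: integrableD => //; exact: I.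
- move=> x _.
  set u := f (x + 0); set v := f (x + a); set w := f (x + (a + b)).
  have := sqr_ge0 ((u - v) - (v - w)); nra.
Qed.

(** Continuity at 0 implies uniform continuity: the increment of [g] is the
    integral of [f x * (f (x + y) - f (x + z))], estimated by
    [2 a b <= e a ^ 2 + b ^ 2 / e]. *)
Lemma autocorrelation_modulus e y z : 0 < e ->
  `|g y - g z| <= e / 2 * g 0 + e^-1 * (g 0 - g (z - y)).
Proof.
move=> e0.
have I a : lambda.-integrable setT (EFin \o (fun x : R => f x * f (x + a))).
  exact: integrable_mul_translate.
have -> : e^-1 * (g 0 - g (z - y)) =
    \int[lambda]_x ((2 * e)^-1 * (f (x + y) - f (x + z)) ^+ 2).
  rewrite RintegralZl//; last exact: integrable_sqr_increment.
  by rewrite integral_sqr_increment; field; exact: lt0r_neq0.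
rewrite autocorrelation0 -RintegralZl// -RintegralB// -RintegralD//; last 2 first.
- rewrite /comp; under eq_fun do rewrite EFinM; apply: integrableZl => //; exact: sqf.
- rewrite /comp; under eq_fun do rewrite EFinM; apply: integrableZl => //.
  exact: integrable_sqr_increment.
apply: le_trans.
  apply: le_normr_Rintegral => //.
  rewrite /comp; under eq_fun do rewrite EFinB; apply: integrableB => //; exact: I.
apply: le_Rintegral => //.
- apply: integrable_norm; rewrite /comp; under eq_fun do rewrite EFinB.
  by apply: integrableB => //; exact: I.
- rewrite /comp; under eq_fun do rewrite EFinD; apply: integrableD => //;
    (rewrite /comp; under eq_fun do rewrite EFinM); apply: integrableZl => //.
  exact: integrable_sqr_increment.
- move=> x _; rewrite -mulrBr normrM (ger0_norm (f_ge0 x)).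
  set u := f x; set v := f (x + y) - f (x + z).
  have -> : v ^+ 2 = `|v| ^+ 2 by rewrite real_normK// num_real.
  rewrite -subr_ge0.
  have -> : e / 2 * u ^+ 2 + (2 * e)^-1 * `|v| ^+ 2 - u * `|v| =
     (2 * e)^-1 * (e * u - `|v|) ^+ 2.
    by field; rewrite lt0r_neq0.
  by rewrite mulr_ge0 ?sqr_ge0// invr_ge0 mulr_ge0// ltW.
Qed.

End SquareIntegrable.

Section DerivativeOfDifferenceCdf.
Context (R : realType) (f : R -> R).
Notation lambda := (@lebesgue_measure R).
Hypothesis mf : measurable_fun setT f.
Hypothesis f_ge0 : forall x, 0 <= f x.
Hypothesis intf : lambda.-integrable setT (EFin \o f).
Hypothesis sqf : lambda.-integrable setT (EFin \o (fun x : R => f x ^+ 2)).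
Local Notation g := (autocorrelation f).
Local Notation S := (difference_cdf f).

Lemma autocorrelationE z :
  (g z)%:E = (\int[lambda]_x (f x * f (x + z)%R)%:E)%E.
Proof.
rewrite fineK//; apply: integrable_fin_num => //.
exact: integrable_mul_translate.
Qed.

Lemma measurable_autocorrelation : measurable_fun setT g.
Proof.
apply/measurable_EFinP.
pose k (p : R * R) := (f p.1 * f (p.1 + p.2))%:E.
have -> : EFin \o g = (fun z => \int[lambda]_x k (x, z))%E.
  by apply/funext => z /=; rewrite autocorrelationE.
apply: measurable_fun_fubini_tonelli_G => //.
  apply/measurable_EFinP; apply: measurable_funM; apply: measurableT_comp => //.
  exact: measurable_funD.
by move=> p; rewrite lee_fin mulr_ge0.
Qed.

Lemma integrable_autocorrelation a (t : R) :
  lambda.-integrable `]0, t] (EFin \o (fun s : R => g (a + s))).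
Proof.
apply: measurable_bounded_integrable => //.
- by rewrite /= lebesgue_measure_itv/=; case: ifP => // _; rewrite -EFinD ltry.
- apply: measurable_funTS; apply: measurableT_comp.
    exact: measurable_autocorrelation.
  exact: measurable_funD.
- exists (g 0); split; first exact: num_real.
  move=> M /ltW gM x _ /=; rewrite ger0_norm ?autocorrelation_ge0//.
  exact: le_trans (autocorrelation_le mf f_ge0 sqf _) gM.
Qed.

(** Tonelli's theorem exchanges the integral defining [g] with the one over
    [s], and the inner integral becomes an increment of [F]. *)
Lemma difference_cdf_increment a t : 0 <= t ->
  S (a + t) - S a = \int[lambda]_(s in `]0, t]) g (a + s).
Proof.
move=> t0; apply: EFin_inj.
rewrite (difference_cdfB mf f_ge0 intf) [RHS]fineK; last first.
  by apply: integrable_fin_num => //; exact: integrable_autocorrelation.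
pose k (p : R * R) := (f p.1 * f (p.1 + (a + p.2)) * \1_(`]0, t]%classic : set R) p.2)%:E.
have k0 p : (0 <= k p)%E by rewrite /k lee_fin !mulr_ge0.
have mk : measurable_fun setT k.
  apply/measurable_EFinP; apply: measurable_funM.
    apply: measurable_funM; apply: measurableT_comp => //.
    by apply: measurable_funD => //; exact: measurable_funD.
  by apply: measurableT_comp.
transitivity (\int[lambda]_x \int[lambda]_s k (x, s))%E.
  apply: eq_integral => x _.
  have := primitiveD mf f_ge0 intf (x + a) t0.
  rewrite EFinM EFinB [(x + (a + t))%R]addrA => ->; rewrite addeAC subee// add0e.
  rewrite -ge0_integralZl//; last 3 first.
  - apply/measurable_funTS/measurable_EFinP/measurableT_comp => //.
    exact: measurable_funD.
  - by move=> s _; rewrite lee_fin.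
  - by rewrite lee_fin.
  rewrite integral_mkcond; apply: eq_integral => s _.
  by rewrite epatch_indic /k/= -!EFinM addrA.
rewrite (@fubini_tonelli _ _ _ _ _ lambda lambda k)//.
rewrite [RHS]integral_mkcond; apply: eq_integral => s _.
rewrite epatch_indic /= autocorrelationE -ge0_integralZr//.
- by apply/measurable_EFinP/measurable_funM => //; exact: measurable_translate.
- by move=> x _; rewrite lee_fin mulr_ge0.
Qed.

Lemma difference_cdf_le t : 0 <= t -> S t - S 0 <= t * g 0.
Proof.
move=> t0; rewrite -[t in S t]add0r difference_cdf_increment//.
have -> : t * g 0 = \int[lambda]_(s in `]0, t]) g 0.
  rewrite Rintegral_cst//= lebesgue_measure_itv/= lte_fin mulrC.
  move: t0; rewrite le_eqVlt => /predU1P[<-|->]; first by rewrite ltxx.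
  by rewrite -EFinD/= subr0.
apply: le_Rintegral => //.
- exact: integrable_autocorrelation.
- apply: measurable_bounded_integrable => //; last exact: bounded_cst.
  by rewrite /= lebesgue_measure_itv/=; case: ifP => // _; rewrite -EFinD ltry.
- by move=> x _; exact: autocorrelation_le.
Qed.

(** Averaging [g 0 - g t <= 2 (g 0 - g (t + s)) + 2 (g 0 - g s)] over [s] in
    [[0, t]] bounds a value of [g] by an average of [g] over [[0, 2 t]], that
    is, by a difference quotient of [S]. *)
Lemma autocorrelation_defect_le t : 0 < t ->
  g 0 - g t <= 4 * (g 0 - (S (2 * t) - S 0) / (2 * t)).
Proof.
move=> t0.
have Ht : lambda (`]0, t] : set R) = t%:E.
  by rewrite /= lebesgue_measure_itv/= lte_fin t0 -EFinD subr0.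
have Ic (c : R) : lambda.-integrable `]0, t] (EFin \o (fun _ : R => c)).
  apply: measurable_bounded_integrable => //; last exact: bounded_cst.
  by rewrite /= Ht ltry.
have Ec c : \int[lambda]_(s in `]0, t]) c = c * t.
  by rewrite Rintegral_cst//= Ht.
have I a := integrable_autocorrelation a t.
have I2 a : lambda.-integrable `]0, t] (EFin \o (fun s : R => 2 * g (a + s))).
  exact: (@integrableZl _ _ _ lambda _ _ 2 _ (I a)).
have : \int[lambda]_(s in `]0, t]) (2 * g (t + s) + 2 * g (0 + s)) <=
       \int[lambda]_(s in `]0, t]) (3 * g 0 + g t).
  apply: le_Rintegral => //.
  - exact: (integrableD _ (I2 t) (I2 0)).
  - move=> s _; have := autocorrelation_defect mf f_ge0 sqf (t + s) (- s).
    rewrite addrK autocorrelationN// add0r; lra.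
rewrite Ec RintegralD// !RintegralZl//.
have t0w := ltW t0.
rewrite -(difference_cdf_increment t t0w) -(difference_cdf_increment 0 t0w) add0r => H.
have -> : 2 * t = t + t by ring.
set D := S (t + t) - S 0.
rewrite -(ler_pM2r t0).
have -> : 4 * (g 0 - D / (t + t)) * t = 4 * g 0 * t - 2 * D.
  by field; rewrite gt_eqF// addr_gt0.
clear -H; rewrite /D {D}; move: (S _) (S _) (S _) (g _) (g _) H => a b c d e; lra.
Qed.

(** The forward difference quotients of [S] at 0 are at most [g 0], and Fatou's bound
    makes their lower limit at least [g 0]; hence they converge to [g 0], which
    by [autocorrelation_defect_le] forces the values of [g] to converge. *)
Lemma autocorrelation_cvg0 : g z @[z --> 0^'+] --> g 0.
Proof.
apply/cvg_at_rightP => u [u0 ucvg].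
pose D n := (S (2 * u n) - S 0) / (2 * u n).
have u20 n : 0 < 2 * u n by rewrite mulr_gt0.
have Dle n : D n <= g 0.
  rewrite ler_pdivrMr// [g 0 * _]mulrC; apply: difference_cdf_le; exact: ltW.
have Dcvg : D @ \oo --> g 0.
  apply/cvgNP; suff : (fun n => (- D n)%:E) @ \oo --> (- g 0)%:E.
    by move=> /fine_cvgP[].
  apply: limn_esup_le_cvg; last by move=> n; rewrite lee_fin lerN2.
  have u2cvg : (fun n => 2 * u n) @ \oo --> 0.
    by rewrite -(mulr0 2); apply: cvgM => //; exact: cvg_cst.
  have := sqr_integral_le_limn_einf mf f_ge0 intf u20 u2cvg.
  have -> : (\int[lambda]_x (f x ^+ 2)%:E)%E = (g 0)%:E.
    by rewrite autocorrelation0 fineK//; exact: integrable_fin_num.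
  by rewrite -leeN2 oppeK.
apply: (@squeeze_cvgr _ _ _ _ (fun n => g 0 - 4 * (g 0 - D n)) (fun _ => g 0)).
- apply: nearW => n; rewrite autocorrelation_le// andbT.
  by have := autocorrelation_defect_le (u0 n); rewrite -/(D n); lra.
- have : (fun n => g 0 - 4 * (g 0 - D n)) @ \oo --> g 0 - 4 * (g 0 - g 0).
    apply: cvgB; first exact: cvg_cst.
    apply: cvgM; first exact: cvg_cst.
    by apply: cvgB => //; exact: cvg_cst.
  by rewrite subrr mulr0 subr0.
- exact: cvg_cst.
Qed.

Lemma continuous_autocorrelation : continuous g.
Proof.
move=> z; apply/cvgrPdist_le => e e0 /=.
(* c makes c / 2 * g 0 at most e / 2, even when g 0 = 0. *)
pose c := e / (g 0 + 1).
have g00 : 0 <= g 0 by exact: autocorrelation_ge0.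
have c0 : 0 < c by rewrite divr_gt0// ltr_wpDl.
have ce0 : 0 < c * e / 2 by rewrite divr_gt0// mulr_gt0.
have /cvgrPdist_le/(_ _ ce0)[d /= d0 gd] := autocorrelation_cvg0.
near=> y.
have zy : `|y - z| < d by near: y; exact: cvgr_distC_lt.
have gzy : g 0 - g (y - z) <= c * e / 2.
  have [->|yz] := eqVneq y z; first by rewrite subrr subrr divr_ge0// mulr_ge0// ltW.
  have := gd `|y - z|; rewrite /= sub0r normrN normr_id normr_gt0 subr_eq0.
  move=> /(_ zy yz); apply: le_trans.
  apply: le_trans (ler_norm _).
  by case: (ger0P (y - z)) => _ //; rewrite autocorrelationN.
apply: le_trans (autocorrelation_modulus mf f_ge0 sqf z y c0) _.
have h1 : c / 2 * g 0 <= e / 2.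
  rewrite mulrAC ler_pM2r ?invr_gt0// /c mulrAC ler_pdivrMr ?ltr_wpDl//.
  by rewrite ler_pM2l// lerDl.
have h2 : c^-1 * (g 0 - g (y - z)) <= e / 2.
  by rewrite mulrC ler_pdivrMr// mulrAC (mulrC e).
by rewrite (le_trans (lerD h1 h2))// -splitr.
Unshelve. all: by end_near. Qed.

Lemma derivable_difference_cdf t :
  derivable S t 1 /\ derive1 S t = g t.
Proof.
(* The fundamental theorem of calculus applies at interior points, so the
   increments are measured from t - 1 and the derivative is taken at 1. *)
pose G (s : R) := g (t - 1 + s).
have cG : {for 1, continuous G}.
  by apply: continuous_comp; [apply: cvgD; [exact: cvg_cst|exact: cvg_id]|
    exact: continuous_autocorrelation].
have [] := @continuous_FTC1 R G (BRight 0) 1 2 _ _ _ cG.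
- by rewrite ltr1n.
- exact: integrable_autocorrelation.
- by rewrite lte_fin.
move=> /= dH dHE; apply/derivable_derive1P.
have /derivable_derive1P := conj dH dHE.
rewrite /G subrK; apply: cvg_trans; apply: near_eq_cvg.
near=> h; congr (_ *: _).
have h1 : 0 <= h + 1.
  rewrite -lerBlDr sub0r lerNl; apply: le_trans (ler_norm _) _.
  by rewrite normrN; near: h; apply: dnbhs0_le.
have St := difference_cdf_increment (t - 1) ler01.
have Sh := difference_cdf_increment (t - 1) h1.
rewrite -Sh -St (_ : t - 1 + (h + 1) = h + t); last ring.
by rewrite subrK opprB addrA subrK.
Unshelve. all: by end_near. Qed.

End DerivativeOfDifferenceCdf.

(** * Smoothing by an integrable kernel *)
Section DominatedConvergence.
Context d (T : measurableType d) (R : realType).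
Variable mu : {measure set T -> \bar R}.

Lemma dominated_cvg_Rintegral (f_ : nat -> T -> R) (f G : T -> R) :
  (forall n, measurable_fun setT (f_ n)) -> measurable_fun setT f ->
  {ae mu, forall x, f_ ^~ x @ \oo --> f x} ->
  mu.-integrable setT (EFin \o G) ->
  (forall n x, `|f_ n x| <= G x) ->
  \int[mu]_x f_ n x @[n --> \oo] --> \int[mu]_x f x.
Proof.
move=> mf_ mf f_f iG f_G.
have [|||||intf _] := @dominated_convergence _ _ _ mu setT measurableT
  (fun n => EFin \o f_ n) (EFin \o f) (EFin \o G).
- by move=> n; exact/measurable_EFinP.
- exact/measurable_EFinP.
- apply: filterS f_f => x f_fx _ /=.
  by apply/fine_cvgP; split; [exact: nearW|exact: f_fx].
- exact: iG.
- by apply: aeW => x n _ /=; rewrite lee_fin.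
by move=> If; apply: fine_cvg; rewrite fineK//; exact: integrable_fin_num.
Qed.

End DominatedConvergence.

Section KernelCdf.
Context (R : realType) (k : R -> R).
Notation lambda := (@lebesgue_measure R).
Hypothesis intk : lambda.-integrable setT (EFin \o k).

Let mk : measurable_fun setT k.
Proof. by have /integrableP[/measurable_EFinP] := intk. Qed.

Lemma kernel_cdfE t :
  kernel_cdf k t = \int[lambda]_u (k u * (u <= t)%R%:R).
Proof.
rewrite /kernel_cdf Rintegral_mkcond; apply: eq_Rintegral => u _.
by rewrite patchE mem_setE in_itv/=; case: ifP => _; rewrite (mulr1, mulr0).
Qed.

Lemma measurable_mul_le t : measurable_fun setT (fun u : R => k u * (u <= t)%R%:R).
Proof.
apply: measurable_funM => //.
have -> : (fun u : R => (u <= t)%R%:R : R) = \1_(`]-oo, t]%classic : set R).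
  by apply/funext => u; rewrite indicE mem_setE in_itv.
exact: measurable_indic.
Qed.

Lemma integrable_mul_le t :
  lambda.-integrable setT (EFin \o (fun u : R => k u * (u <= t)%R%:R)).
Proof.
apply: le_integrable intk => //.
  by apply/measurable_EFinP; exact: measurable_mul_le.
by move=> u _ /=; rewrite lee_fin normrM ler_piMr// normr_nat lern1 leq_b1.
Qed.

Lemma kernel_cdf_bounded t : `|kernel_cdf k t| <= \int[lambda]_u `|k u|.
Proof.
rewrite kernel_cdfE; apply: le_trans (le_normr_Rintegral _ _) _ => //.
  exact: integrable_mul_le.
apply: le_Rintegral => //.
- exact/integrable_norm/integrable_mul_le.
- exact: integrable_norm.
- by move=> u _; rewrite normrM ler_piMr// normr_nat lern1 leq_b1.
Qed.

Lemma measurable_kernel_cdf : measurable_fun setT (kernel_cdf k).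
Proof.
have ik := integrable_norm intk.
(* k is a difference of nonnegative integrable functions, whose primitives are
   monotone. *)
pose k' u := `|k u| - k u.
have ik' : lambda.-integrable setT (EFin \o k').
  by have := integrableB measurableT ik intk.
have -> : kernel_cdf k = primitive (fun u => `|k u|) \- primitive k'.
  apply/funext => t /=; rewrite /primitive -RintegralB//.
  - by apply: eq_Rintegral => u _; rewrite /k' subKr.
  - exact: integrableS ik.
  - exact: integrableS ik'.
apply: measurable_funB; apply: measurable_primitive => //.
- exact: measurableT_comp.
- by apply: measurable_funB => //; exact: measurableT_comp.
- by move=> u; rewrite subr_ge0 ler_norm.
Qed.

(** [K (z / h)] is the integral of [k] over the [u] with [h u <= z], a set that
    exhausts the line if [z > 0] and shrinks to the empty set if [z < 0]. *)
Lemma kernel_cdf_cvg_psi (h : R^nat) (z : R) : \int[lambda]_u k u = 1 ->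
  (forall n, 0 < h n) -> h @ \oo --> 0 -> z != 0 ->
  kernel_cdf k (z / h n) @[n --> \oo] --> psi z.
Proof.
move=> k1 h0 hcvg z0.
under eq_fun do rewrite kernel_cdfE.
have -> : psi z = \int[lambda]_u (k u * psi z) by rewrite RintegralZr// k1 mul1r.
apply: dominated_cvg_Rintegral (integrable_norm intk) _.
- by move=> n; exact: measurable_mul_le.
- exact: measurable_funM.
- apply: aeW => u; apply: cvgM; first exact: cvg_cst.
  apply: cvg_near_cst.
  have hu : (h n * u) @[n --> \oo] --> 0 * u by apply: cvgM => //; exact: cvg_cst.
  rewrite mul0r in hu; rewrite /psi.
  have [zlt|zgt|/eqP] := ltgtP z 0; last by rewrite (negbTE z0).
  + move/cvgr_gt : hu => /(_ _ zlt); apply: filterS => n hn.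
    by rewrite ler_pdivlMr// mulrC leNgt hn.
  + move/cvgr_lt : hu => /(_ _ zgt); apply: filterS => n hn.
    by rewrite ler_pdivlMr// mulrC ltW.
- by move=> n u; rewrite normrM ler_piMr// normr_nat lern1 leq_b1.
Qed.

End KernelCdf.

Section RintegralFubini.
Context d1 d2 (T1 : measurableType d1) (T2 : measurableType d2) (R : realType).
Variables (m1 : {sigma_finite_measure set T1 -> \bar R})
          (m2 : {sigma_finite_measure set T2 -> \bar R}).

Lemma Rintegral_Fubini (f : T1 * T2 -> R) :
  (m1 \x m2)%E.-integrable setT (EFin \o f) ->
  (forall x, m2.-integrable setT (EFin \o (fun y => f (x, y)))) ->
  (forall y, m1.-integrable setT (EFin \o (fun x => f (x, y)))) ->
  \int[m1]_x \int[m2]_y f (x, y) = \int[m2]_y \int[m1]_x f (x, y).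
Proof.
move=> intf if2 if1; have := Fubini intf; rewrite /Rintegral => FE.
have E1 x : (\int[m2]_y (f (x, y))%:E = (fine (\int[m2]_y (f (x, y))%:E))%:E)%E.
  by rewrite fineK//; exact: integrable_fin_num (if2 x).
have E2 y : (\int[m1]_x (f (x, y))%:E = (fine (\int[m1]_x (f (x, y))%:E))%:E)%E.
  by rewrite fineK//; exact: integrable_fin_num (if1 y).
congr fine; under eq_integral do rewrite -E1.
by under [RHS]eq_integral do rewrite -E2.
Qed.

End RintegralFubini.

Section KernelMean.
Context d (T : measurableType d) (R : realType) (nu : probability T R).
Variables (Z : T -> R) (k : R -> R).
Notation lambda := (@lebesgue_measure R).
Hypothesis mZ : measurable_fun setT Z.
Hypothesis intk : lambda.-integrable setT (EFin \o k).

Lemma measurable_psi : measurable_fun setT (@psi R).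
Proof.
apply: nondecreasing_measurable => // x y xy; rewrite /psi.
by case: ifP => [x0|_]; [rewrite (le_trans x0 xy)|case: ifP].
Qed.

Lemma psi_norm_le1 (x : R) : `|psi x| <= 1.
Proof. by rewrite /psi; case: ifP; rewrite ?normr1 ?normr0. Qed.

(** Smoothing [psi] and then averaging over [Z] amounts to averaging [psi] over
    [Z] and then smoothing the resulting function of the shift, since
    [u <= (Z + t) / h] means [0 <= Z + (t - h u)]. *)
Lemma integral_kernel_cdf (h t : R) : 0 < h ->
  \int[nu]_x kernel_cdf k ((Z x + t) / h) =
  \int[lambda]_u (k u * \int[nu]_x psi (Z x + (t - h * u))).
Proof.
move=> h0.
pose f (p : T * R) := k p.2 * psi (Z p.1 + (t - h * p.2)).
have mk : measurable_fun setT k by have /integrableP[/measurable_EFinP] := intk.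
have mf : measurable_fun setT f.
  apply: measurable_funM; first exact: measurableT_comp.
  apply: measurableT_comp; first exact: measurable_psi.
  apply: measurable_funD; first exact: measurableT_comp.
  by apply: measurable_funB => //; exact: measurable_funM.
have f_le x u : `|f (x, u)| <= `|k u| by rewrite normrM ler_piMr// psi_norm_le1.
have if2 x : lambda.-integrable setT (EFin \o (fun u : R => f (x, u))).
  apply: le_integrable intk => //; first exact/measurable_EFinP/measurableT_comp.
  by move=> u _; rewrite lee_fin f_le.
have if1 u : nu.-integrable setT (EFin \o (fun x => f (x, u))).
  apply: measurable_bounded_integrable => //.
  - by rewrite /= probability_setT ltry.
  - exact: measurableT_comp.
  - exists `|k u|; split; first exact: num_real.
    by move=> M /ltW kM x _; exact: le_trans (f_le x u) kM.
have intf : (nu \x lambda)%E.-integrable setT (EFin \o f).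
  apply/integrable12ltyP; first exact/measurable_EFinP.
  have [_ Ik] := integrableP _ _ _ intk.
  apply: le_lt_trans Ik.
  have -> : (\int[lambda]_x `|(EFin \o k) x| =
      \int[nu]_x \int[lambda]_x `|(EFin \o k) x|)%E.
    by rewrite integral_cst//= probability_setT mule1.
  apply: ge0_le_integral => //.
  - by move=> x _; exact: integral_ge0.
  - apply: (@measurable_fun_fubini_tonelli_F _ _ _ _ _ lambda
      (abse \o (EFin \o f))) => //.
    exact/measurableT_comp/measurable_EFinP.
    by move=> p; exact: abse_ge0.
  - move=> x _; apply: ge0_le_integral => //.
    + by apply/measurableT_comp => //; exact/measurable_EFinP/measurableT_comp.
    + by apply/measurableT_comp => //; exact/measurable_EFinP.
    + by move=> u _; rewrite lee_fin f_le.
transitivity (\int[nu]_x \int[lambda]_u f (x, u)).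
  apply: eq_Rintegral => x _; rewrite kernel_cdfE; apply: eq_Rintegral => u _.
  rewrite /f/= /psi addrA subr_ge0 ler_pdivlMr// [h * u]mulrC.
  by case: ifP.
rewrite Rintegral_Fubini//; apply: eq_Rintegral => u _.
rewrite -RintegralZl//; apply: measurable_bounded_integrable => //.
- by rewrite /= probability_setT ltry.
- apply: measurableT_comp; first exact: measurable_psi.
  exact: measurable_funD.
- exists 1; split; first exact: num_real.
  by move=> M /ltW M1 x _; exact: le_trans (psi_norm_le1 _) M1.
Qed.

End KernelMean.

Section SmoothedDerivative.
Context (R : realType) (k S g : R -> R) (M : R).
Notation lambda := (@lebesgue_measure R).
Hypothesis intk : lambda.-integrable setT (EFin \o k).
Hypothesis dS : forall t, derivable S t 1 /\ derive1 S t = g t.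
Hypothesis SM : forall t, `|S t| <= M.
Hypothesis gM : forall t, `|g t| <= M.
Hypothesis mg : measurable_fun setT g.

Let mk : measurable_fun setT k.
Proof. by have /integrableP[/measurable_EFinP] := intk. Qed.

Let mS : measurable_fun setT S.
Proof.
apply: continuous_measurable_fun => t; apply: differentiable_continuous.
by apply/derivable1_diffP; have [] := dS t.
Qed.

Lemma derivable_smoothed h :
  let s t := \int[lambda]_u (k u * S (t - h * u)) in
  derivable s 0 1 /\ derive1 s 0 = \int[lambda]_u (k u * g (- (h * u))).
Proof.
pose f t u := k u * S (t - h * u).
have mh t : measurable_fun setT (fun u : R => t - h * u).
  by apply: measurable_funB => //; exact: measurable_funM.
have dfE t u : derivable (f ^~ u) t 1 /\ derive1 (f ^~ u) t = k u * g (t - h * u).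
  apply/derivable_derive1P.
  have /derivable_derive1P := dS (t - h * u).
  move=> /(cvgM (cvg_cst (k u))); apply: cvg_trans; apply: near_eq_cvg.
  apply: nearW => x; rewrite /f /= addrA -mulrBr mulrCA.
  by [].
have Ia : (`]-1, 1[%classic : set R) 0 by rewrite /= in_itv/= ltrN10 ltr01.
have intf t : lambda.-integrable setT (EFin \o f t).
  apply: (@le_integrable _ _ _ lambda setT measurableT _
    (EFin \o (fun u => M * k u))) => //.
  - apply/measurable_EFinP/measurable_funM => //.
    exact: (measurableT_comp mS (mh t)).
  - move=> u _ /=; rewrite lee_fin !normrM mulrC ler_wpM2r//.
    exact: le_trans (SM _) (ler_norm _).
  - exact: (@integrableZl _ _ _ lambda _ _ M _ intk).
have M0 : 0 <= M := le_trans (normr_ge0 _) (gM 0).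
have iG : lambda.-integrable setT (EFin \o (fun u => M * `|k u|)).
  exact: (@integrableZl _ _ _ lambda _ _ M _ (integrable_norm intk)).
have G0 (u : R) : 0 <= M * `|k u| by rewrite mulr_ge0.
have dG t (u : R) : `|partial1of2 f t u| <= M * `|k u|.
  by rewrite /partial1of2 (dfE t u).2 normrM mulrC ler_wpM2r.
have df t (u : R) : derivable (f ^~ u) t 1 by have [] := dfE t u.
split.
  by apply: (@derivable_under_integral R _ _ lambda f setT measurableT 0 (-1) 1
    Ia _ _ _ G0) => //.
rewrite (@differentiation_under_integral R _ _ lambda f setT measurableT 0 (-1) 1
  Ia _ _ _ G0)//.
by apply: eq_Rintegral => u _; rewrite /partial1of2 (dfE 0 u).2 sub0r.
Qed.

Lemma smoothed_derivative_cvg (h : R^nat) :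
  h @ \oo --> 0 -> {for 0, continuous g} ->
  \int[lambda]_u (k u * g (- (h n * u))) @[n --> \oo] -->
  \int[lambda]_u k u * g 0.
Proof.
move=> h0 cg.
rewrite -RintegralZr//.
apply: (@dominated_cvg_Rintegral _ _ _ lambda _ _ (fun u => M * `|k u|)).
- move=> n; apply: measurable_funM => //; apply: measurableT_comp => //.
  by apply: measurable_funN; exact: measurable_funM.
- exact: measurable_funM.
- apply: aeW => u; apply: cvgM; first exact: cvg_cst.
  have hu : (- (h n * u)) @[n --> \oo] --> 0.
    by have := cvgN (cvgM h0 (cvg_cst u)); rewrite mul0r oppr0; apply.
  exact: (cvg_comp _ _ hu cg).
- exact: (@integrableZl _ _ _ lambda _ _ M _ (integrable_norm intk)).
- by move=> n u; rewrite normrM mulrC ler_wpM2r.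
Qed.

End SmoothedDerivative.

(** * Laws on the line and on products *)
Section RayUniqueness.
Context (R : realType).

(** Rays form a pi-system generating the Borel sets. *)
Lemma ray_measure_unique (m1 m2 : {measure set R -> \bar R}) :
  (forall x, (m1 `]-oo, x]%classic < +oo)%E) ->
  (forall x, m1 `]-oo, x]%classic = m2 `]-oo, x]%classic) ->
  forall A, measurable A -> m1 A = m2 A.
Proof.
move=> m1y m12 A mA.
pose G : set (set R) := [set B | exists x, B = `]-oo, x]%classic].
apply: (measure_unique G (fun n => `]-oo, n%:R]%classic)) => //.
- rewrite eqEsubset; split => B.
    apply: smallest_sub; first exact: smallest_sigma_algebra.
    move=> _ [[a b] _ <-]/=.
    have -> : `]a, b]%classic = `]-oo, b] `\` `]-oo, a] :> set R.
      by rewrite -[RHS]setCK setCD setCitvl setUC -[LHS]setCK setCitv.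
    by apply: (@measurableD _ (g_sigma_algebraType G));
      apply: sub_sigma_algebra; eexists.
  apply: smallest_sub; first exact: sigma_algebra_measurable.
  by move=> _ [x ->]; exact: measurable_itv.
- move=> _ _ [x ->] [y ->]; exists (Num.min x y).
  by apply/seteqP; split => z /=; rewrite !in_itv/= le_min => /andP.
- by move=> n; exists n%:R.
- rewrite -subTset => x _; exists (Num.truncn x).+1 => //=.
  by rewrite in_itv/= ltW// truncnS_gt.
- by move=> _ [x ->].
Qed.

End RayUniqueness.

Section Density.
Context (R : realType) (f : R -> R).
Notation lambda := (@lebesgue_measure R).
Hypothesis mf : measurable_fun setT f.
Hypothesis f_ge0 : forall x, 0 <= f x.

Definition density_measure (A : set R) : \bar R :=
  (\int[lambda]_(x in A) (f x)%:E)%E.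

Let density0 : density_measure set0 = 0%E.
Proof. exact: integral_set0. Qed.

Let density_ge0 A : (0 <= density_measure A)%E.
Proof. by apply: integral_ge0 => x _; rewrite lee_fin. Qed.

Let density_sigma_additive : semi_sigma_additive density_measure.
Proof.
move=> /= A mA tA mUA; rewrite /density_measure ge0_integral_bigcup//.
- apply: is_cvg_ereal_nneg_natsum_cond => n _ _.
  by apply: integral_ge0 => x _; rewrite lee_fin.
- exact/measurable_funTS/measurable_EFinP.
- by move=> x _; rewrite lee_fin.
Qed.

HB.instance Definition _ := isMeasure.Build _ _ _
  density_measure density0 density_ge0 density_sigma_additive.

Variable nu : probability R R.
Hypothesis nu_ray :
  forall x, nu `]-oo, x]%classic = (\int[lambda]_(t in `]-oo, x]) (f t)%:E)%E.

Lemma probability_density A : measurable A ->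
  nu A = (\int[lambda]_(x in A) (f x)%:E)%E.
Proof.
apply: (ray_measure_unique (m2 := density_measure)) => //.
by move=> x; rewrite (le_lt_trans (probability_le1 _ _)) ?ltry.
Qed.

Lemma integrable_density : lambda.-integrable setT (EFin \o f).
Proof.
apply/integrableP; split; first exact/measurable_EFinP.
under eq_integral do rewrite /= ger0_norm//.
by rewrite -probability_density// probability_setT ltry.
Qed.

(** The real line carries two displays for its Borel sets; this identity map
    transports a law to the one of the Lebesgue measure. *)
Let idL : R -> measurableTypeR R := idfun.

#[local] HB.instance Definition _ :=
  @isMeasurableFun.Build _ _ R (measurableTypeR R) idL (@measurable_id _ _ setT).

(** The given density is almost everywhere the Radon-Nikodym derivative, for
    which the change of variables formula is known. *)
Lemma ge0_integral_density (phi : R -> R) : measurable_fun setT phi ->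
  (forall x, 0 <= phi x) ->
  (\int[nu]_x (phi x)%:E = \int[lambda]_x (phi x * f x)%:E)%E.
Proof.
move=> mphi phi0.
pose nuL : probability (measurableTypeR R) R :=
  distribution nu (idL : {mfun R >-> measurableTypeR R}).
have nulambda : nuL `<< lambda.
  apply/null_content_dominatesP => A mA A0.
  rewrite [LHS]probability_density//; apply: null_set_integral => //.
  by apply: measurable_funTS; exact/measurable_EFinP.
transitivity (\int[nuL]_x (phi x)%:E)%E.
  by rewrite ge0_integral_distribution//; exact/measurable_EFinP.
rewrite -(@Radon_Nikodym_SigmaFinite.change_of_variables _ _ _ nuL lambda)//; last first.
  exact/measurable_EFinP.
have intRN := Radon_Nikodym_SigmaFinite.f_integrable nulambda.
apply: ae_eq_integral => //.
- apply: emeasurable_funM; first exact/measurable_EFinP.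
  exact: measurable_int intRN.
- by apply/measurable_EFinP/measurable_funM.
- under [X in ae_eq _ _ _ X]eq_fun do rewrite EFinM.
  apply: ae_eqe_mul2l; apply: integral_ae_eq => //.
  + exact/measurable_EFinP.
  + move=> E _ mE; rewrite -Radon_Nikodym_SigmaFinite.f_integral//.
    exact: probability_density.
Qed.

End Density.

Section DifferenceLaw.
Context (R : realType) (f : R -> R) (mu : probability R R).
Notation lambda := (@lebesgue_measure R).
Hypothesis mf : measurable_fun setT f.
Hypothesis f_ge0 : forall x, 0 <= f x.
Hypothesis mu_ray :
  forall x, mu `]-oo, x]%classic = (\int[lambda]_(t in `]-oo, x]) (f t)%:E)%E.

Lemma measurable_psi_difference (t : R) :
  measurable_fun setT (fun p : R * R => psi (p.2 - p.1 + t)).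
Proof.
apply: measurableT_comp; first exact: measurable_psi.
by apply: measurable_funD => //; exact: measurable_funB.
Qed.

Lemma psi_ge0 (x : R) : 0 <= psi x. Proof. by rewrite /psi; case: ifP. Qed.

Lemma integral_psi_difference t :
  \int[(mu \x mu)%E]_p psi (p.2 - p.1 + t) = difference_cdf f t.
Proof.
have intf := integrable_density mf f_ge0 mu_ray.
rewrite /Rintegral fubini_tonelli2; last 2 first.
- by apply/measurable_EFinP; exact: measurable_psi_difference.
- by move=> p; rewrite lee_fin psi_ge0.
rewrite /difference_cdf /Rintegral; congr fine.
transitivity (\int[mu]_y (primitive f (y + t))%:E)%E.
  apply: eq_integral => y _; rewrite primitiveE// -mu_ray.
  rewrite -[X in mu X]setIT -integral_indic//.
  apply: eq_integral => x _; rewrite indicE mem_setE in_itv/= /psi.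
  by rewrite addrAC subr_ge0; case: ifP.
rewrite (ge0_integral_density mf f_ge0 mu_ray)//.
- by apply: eq_integral => x _; rewrite mulrC.
- apply: measurableT_comp; first exact: measurable_primitive.
  exact: measurable_funD.
- by move=> x; exact: primitive_ge0.
Qed.

Lemma ae_difference_neq0 : {ae (mu \x mu)%E, forall p, p.2 - p.1 != 0}.
Proof.
exists [set p | p.2 - p.1 = 0]; split.
- have -> : [set p : R * R | p.2 - p.1 = 0] = setT `&` (fun p => p.2 - p.1) @^-1` [set 0].
    by rewrite setTI.
  have m : measurable_fun setT (fun p : R * R => p.2 - p.1) by exact: measurable_funB.
  by apply: m.
- rewrite /= /product_measure1; apply: integral0_eq => x _ /=.
  have -> : xsection [set p : R * R | p.2 - p.1 = 0] x = [set x].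
    apply/seteqP; split => y; rewrite /xsection/= inE/=.
      by move=> /eqP; rewrite subr_eq0 => /eqP.
    by move=> ->; exact: subrr.
  by rewrite (probability_density mf f_ge0 mu_ray)// integral_set1.
- by move=> p /= /negP; rewrite negbK => /eqP.
Qed.

End DifferenceLaw.

Section JointLaw.
Context d d1 d2 (T : measurableType d) (T1 : measurableType d1)
  (T2 : measurableType d2) (R : realType).
Variables (Q : probability T R) (nu1 : probability T1 R) (nu2 : probability T2 R).
Variables (U : T -> T1) (V : T -> T2).
Hypotheses (mU : measurable_fun setT U) (mV : measurable_fun setT V).

(** Rectangles form a pi-system generating the product sigma-algebra, so two
    finite measures that agree on them are equal.  The event [E] and the factor
    [c] allow the lemma to be iterated: independence of four variables is
    extended from rectangles to pairs, one pair at a time. *)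
Lemma rectangle_extension (E : set T) (c : {nonneg R}) : measurable E ->
  (forall A B, measurable A -> measurable B ->
     Q (U @^-1` A `&` V @^-1` B `&` E) = c%:num%:E * (nu1 A * nu2 B))%E ->
  forall C, measurable C ->
    Q ((fun x => (U x, V x)) @^-1` C `&` E) = (c%:num%:E * (nu1 \x nu2) C)%E.
Proof.
move=> mE rect C mC.
pose W x := (U x, V x).
have mW : measurable_fun setT W by exact: measurable_fun_pair.
pose m1 : {measure set (T1 * T2) -> \bar R} := mscale c (nu1 \x nu2)%E.
pose m2 : {measure set (T1 * T2) -> \bar R} := pushforward (mrestr Q mE) W.
pose G : set (set (T1 * T2)) :=
  [set D | exists A, measurable A /\ exists B, measurable B /\ D = A `*` B].
suff -> : (c%:num%:E * (nu1 \x nu2) C)%E = m1 C.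
  suff : m1 C = m2 mW C by move=> ->.
  apply: (measure_unique G (fun=> setT)) => //.
  - rewrite measurable_prod_measurableType; congr (<<s _ >>).
    apply/seteqP; split=> D.
      by move=> [A mA [B mB <-]]; exists A; split => //; exists B.
    by move=> [A [mA [B [mB ->]]]]; exists A => //; exists B.
  - move=> _ _ [A1 [mA1 [B1 [mB1 ->]]]] [A2 [mA2 [B2 [mB2 ->]]]].
    rewrite -setXI; exists (A1 `&` A2); split; first exact: measurableI.
    by exists (B1 `&` B2); split => //; exact: measurableI.
  - by move=> _; exists setT; split => //; exists setT; rewrite setXTT.
  - exact: bigcup_const.
  - move=> _ [A [mA [B [mB ->]]]].
    rewrite -[LHS]/(c%:num%:E * (nu1 \x nu2) (A `*` B))%E.
    rewrite product_measure1E//; exact/esym/rect.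
  - move=> _; rewrite -[ltLHS]/(c%:num%:E * (nu1 \x nu2) setT)%E.
    by rewrite probability_setT mule1 ltry.
by [].
Qed.

Lemma product_law :
  (forall A B, measurable A -> measurable B ->
     Q (U @^-1` A `&` V @^-1` B) = (nu1 A * nu2 B)%E) ->
  forall C, measurable C -> Q ((fun x => (U x, V x)) @^-1` C) = (nu1 \x nu2)%E C.
Proof.
move=> rect C mC; rewrite -[X in Q X]setIT.
rewrite (@rectangle_extension setT 1%:nng)//= ?mul1e// => A B mA mB.
by rewrite setIT mul1e rect.
Qed.

End JointLaw.

Section TransferOfExpectation.
Context d d' (T : measurableType d) (T' : measurableType d') (R : realType).
Variables (Q : probability T R) (nu : probability T' R) (W : T -> T').
Hypothesis mW : measurable_fun setT W.

Lemma integrable_bounded (H : T -> R) (B : R) : measurable_fun setT H ->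
  (forall x, `|H x| <= B) -> Q.-integrable setT (EFin \o H).
Proof.
move=> mH HB; apply: measurable_bounded_integrable => //.
  by rewrite /= probability_setT ltry.
exists B; split; first exact: num_real.
by move=> M /ltW BM x _; exact: le_trans (HB x) BM.
Qed.

Lemma Rintegral_of_law (H : T' -> R) (B : R) : measurable_fun setT H ->
  (forall x, `|H x| <= B) ->
  (forall C, measurable C -> Q (W @^-1` C) = nu C) ->
  \int[Q]_w H (W w) = \int[nu]_x H x.
Proof.
move=> mH HB law; congr fine.
transitivity (\int[pushforward Q W]_x (H x)%:E)%E.
  rewrite (@integral_pushforward _ _ _ _ _ _ mW Q setT (EFin \o H))//.
    exact/measurable_EFinP.
  apply: (integrable_bounded (B := B)) => //; exact: measurableT_comp.
by apply: eq_measure_integral => C mC _; exact: law.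
Qed.

End TransferOfExpectation.

(** * Joint laws in the two-sample location model *)
Section TwoSampleLaws.
Context (d : measure_display) (Omega : measurableType d) (R : realType).
Variables (P : R -> probability Omega R) (X Y : nat -> {mfun Omega >-> R}).
Variables (F f : R -> R).
Notation lambda := (@lebesgue_measure R).
Hypothesis hdens : has_density F f.
Hypothesis hmodel : two_sample_location P X Y F.

Definition null_law : probability R R := distribution (P 0) (X 0%N).

Local Notation mu := null_law.
Local Notation Z := (pooled X Y).

Lemma null_law_ray x :
  mu `]-oo, x]%classic = (\int[lambda]_(t in `]-oo, x]) (f t)%:E)%E.
Proof.
have [_ cdfX _] := hmodel 0; have [_ _ FE] := hdens.
by rewrite -FE -(cdfX 0%N).
Qed.

Lemma law_of_cdf (Q : probability Omega R) (V : Omega -> R) :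
  measurable_fun setT V ->
  (forall x, Q (V @^-1` `]-oo, x]) = (F x)%:E) ->
  forall A, measurable A -> Q (V @^-1` A) = mu A.
Proof.
move=> mV cdfV A mA; have [_ cdfX _] := hmodel 0.
pose m : {measure set R -> \bar R} := pushforward Q V.
transitivity (m mV A) => //.
apply: (ray_measure_unique (m1 := m mV)) => //.
  by move=> x; rewrite /= /pushforward cdfV ltry.
by move=> x; rewrite /= /pushforward cdfV -(cdfX 0%N).
Qed.

Lemma law_first_sample t i A : measurable A -> P t (X i @^-1` A) = mu A.
Proof.
move=> mA; have [_ cdfX _] := hmodel t.
by apply: law_of_cdf => // x; rewrite -(cdfX i).
Qed.

(** Centring [Y_j] by the shift reduces every shift to the null law. *)
Lemma law_second_sample t j A : measurable A ->
  P t ((fun w => Y j w - t) @^-1` A) = mu A.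
Proof.
move=> mA; have [_ _ cdfY] := hmodel t.
apply: law_of_cdf => // [|x]; first exact: measurable_funB.
rewrite -[x in F x](addrK t) -(cdfY j); congr (P t _).
by apply/seteqP; split => w /=; rewrite !in_itv/= lerBlDr.
Qed.

Lemma law_pooled i A : measurable A -> P 0 (Z i @^-1` A) = mu A.
Proof.
case: i => i mA; first exact: law_first_sample.
rewrite -(law_second_sample 0 i mA); congr (P 0 _).
by apply/funext => w /=; rewrite subr0.
Qed.

Lemma expectation_pair t i j (phi : R -> R) (B : R) :
  measurable_fun setT phi -> (forall x, `|phi x| <= B) ->
  \int[P t]_w phi (Y j w - X i w) =
  \int[(mu \x mu)%E]_p phi (p.2 - p.1 + t).
Proof.
move=> mphi phiB.
pose V w := Y j w - t.
have mV : measurable_fun setT V by exact: measurable_funB.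
pose H (p : R * R) := phi (p.2 - p.1 + t).
have mH : measurable_fun setT H.
  apply: measurableT_comp => //.
  by apply: measurable_funD => //; exact: measurable_funB.
rewrite -[RHS](@Rintegral_of_law _ _ _ _ _ (P t) (mu \x mu)%E
  (fun w => (X i w, V w)) _ H B) => //.
- apply: eq_Rintegral => w _; rewrite /H/V/=; congr phi; ring.
- exact: measurable_fun_pair.
- by move=> p; exact: phiB.
- apply: product_law => // A A' mA mA'.
  have [indep _ _] := hmodel t.
  pose D (l : nat + nat) : set R := if l is inl _ then A else (fun y => y - t) @^-1` A'.
  have mD l : measurable (D l).
    case: l => [//|l]; rewrite /D -[X in measurable X]setTI.
    by apply: (measurable_funB (@measurable_id _ R setT) (measurable_cst t)) => //.
  have := indep [:: inl i; inr j] D isT mD.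
  rewrite !big_cons !big_nil/= setIT mule1 => ->.
  by rewrite (law_first_sample t i mA) (law_second_sample t j mA').
Qed.

End TwoSampleLaws.

Definition pair_law (R : realType) (mu : probability R R) :
  probability (R * R)%type R := (mu \x mu)%E.

Definition four_sample_law (R : realType) (mu : probability R R) :
  probability ((R * R) * (R * R))%type R := (pair_law mu \x pair_law mu)%E.

Section FourSamples.
Context (d : measure_display) (Omega : measurableType d) (R : realType).
Variables (P : R -> probability Omega R) (X Y : nat -> {mfun Omega >-> R}).
Variable F : R -> R.
Hypothesis hmodel : two_sample_location P X Y F.

Local Notation mu := (null_law P X).
Local Notation mu2 := (pair_law mu).
Local Notation mu4 := (four_sample_law mu).
Local Notation Z := (pooled X Y).

(** Two summands [phi (Y_j - X_i)] involve at most four observations; pairs of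
    pairs make their law a square of a square, to which Fubini's theorem
    applies. *)
Definition four_samples (i1 i2 i3 i4 : nat + nat) (w : Omega) : (R * R) * (R * R) :=
  ((Z i1 w, Z i2 w), (Z i3 w, Z i4 w)).

Lemma measurable_four_samples i1 i2 i3 i4 :
  measurable_fun setT (four_samples i1 i2 i3 i4).
Proof. by apply: measurable_fun_pair; exact: measurable_fun_pair. Qed.

Lemma four_rectangle i1 i2 i3 i4 A1 A2 A3 A4 : uniq [:: i1; i2; i3; i4] ->
  measurable A1 -> measurable A2 -> measurable A3 -> measurable A4 ->
  P 0 (Z i1 @^-1` A1 `&` (Z i2 @^-1` A2 `&` (Z i3 @^-1` A3 `&` Z i4 @^-1` A4))) =
  (mu A1 * (mu A2 * (mu A3 * mu A4)))%E.
Proof.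
move=> u mA1 mA2 mA3 mA4; have [indep _ _] := hmodel 0.
pose D l : set R := if l == i1 then A1 else if l == i2 then A2 else
  if l == i3 then A3 else A4.
have mD l : measurable (D l) by rewrite /D; do 3 case: ifP => //.
have := indep _ D u mD.
rewrite !big_cons !big_nil setIT mule1 !(law_pooled hmodel)//.
have [D1 D2 D3 D4] : [/\ D i1 = A1, D i2 = A2, D i3 = A3 & D i4 = A4].
  move: u; rewrite /D /= !inE !negb_or.
  move=> /and4P[/and3P[n12 n13 n14] /andP[n23 n24] n34 _].
  rewrite !eqxx [i2 == _]eq_sym (negbTE n12) [i3 == i1]eq_sym (negbTE n13).
  by rewrite [i3 == i2]eq_sym (negbTE n23) ![i4 == _]eq_sym (negbTE n14)
    (negbTE n24) (negbTE n34).
by rewrite D1 D2 D3 D4.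
Qed.

Lemma four_samples_joint_law i1 i2 i3 i4 : uniq [:: i1; i2; i3; i4] ->
  forall C, measurable C ->
  P 0 (four_samples i1 i2 i3 i4 @^-1` C) = mu4 C.
Proof.
move=> u.
have m12 : measurable_fun setT (fun w => (Z i1 w, Z i2 w)) by exact: measurable_fun_pair.
have m34 : measurable_fun setT (fun w => (Z i3 w, Z i4 w)) by exact: measurable_fun_pair.
have mpre g (mg : measurable_fun setT g) : forall B : set (R * R), measurable B ->
    measurable (g @^-1` B : set Omega).
  by move=> B mB; rewrite -[X in measurable X]setTI; exact: mg.
(* First freeze the event on the second pair and extend over the first pair,
   then freeze a rectangle for the first pair and extend over the second. *)
apply: product_law => // A B mA mB.
have c2 : {c : {nonneg R} | c%:num%:E = mu2 B}.
  exists (NngNum (fine_ge0 (measure_ge0 mu2 B))).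
  by rewrite fineK// fin_num_measure.
case: c2 => c2 c2E.
rewrite -c2E muleC.
apply: rectangle_extension => //; first exact: mpre.
move=> A1 A2 mA1 mA2; rewrite c2E setIC.
have c1 : {c : {nonneg R} | c%:num%:E = (mu A1 * mu A2)%E}.
  exists (NngNum (fine_ge0 (mule_ge0 (measure_ge0 mu A1) (measure_ge0 mu A2)))).
  by rewrite /= fineK// fin_numM// fin_num_measure.
case: c1 => c1 c1E; rewrite -c1E muleC.
apply: rectangle_extension => //.
  by apply: measurableI; exact: measurable_funPTI.
move=> A3 A4 mA3 mA4; rewrite c1E setIC -setIA four_rectangle//.
by rewrite !muleA.
Qed.

(** Exchangeability under the null law: the right-hand side does not depend on
    the choice of the four distinct observations, nor on the samples that they
    come from. *)
Lemma expectation_four i1 i2 i3 i4 (H : (R * R) * (R * R) -> R) (B : R) :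
  uniq [:: i1; i2; i3; i4] ->
  measurable_fun setT H -> (forall x, `|H x| <= B) ->
  \int[P 0]_w H (four_samples i1 i2 i3 i4 w) = \int[mu4]_x H x.
Proof.
move=> u mH HB; apply: Rintegral_of_law mH HB _; first exact: measurable_four_samples.
exact: four_samples_joint_law.
Qed.

End FourSamples.

(** * Mean and null variance of a sum over pairs *)
Section SumOfIntegrals.
Context d (T : measurableType d) (R : realType) (Q : probability T R).

Lemma integrable_Rsum (I : Type) (r : seq I) (f : I -> T -> R) :
  (forall i, Q.-integrable setT (EFin \o f i)) ->
  Q.-integrable setT (EFin \o (fun x => \sum_(i <- r) f i x)).
Proof.
move=> intf; have := integrable_sum measurableT r (P := xpredT) (fun i _ => intf i).
by apply: eq_integrable => // x _; rewrite /= sumEFin.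
Qed.

Lemma Rintegral_sum (I : Type) (r : seq I) (f : I -> T -> R) :
  (forall i, Q.-integrable setT (EFin \o f i)) ->
  \int[Q]_x \sum_(i <- r) f i x = \sum_(i <- r) \int[Q]_x f i x.
Proof.
move=> intf; elim: r => [|i r IH].
  rewrite big_nil; under eq_Rintegral do rewrite big_nil.
  by rewrite Rintegral_cst// mul0r.
rewrite big_cons -IH -RintegralD//; last exact: integrable_Rsum.
by apply: eq_Rintegral => x _; rewrite big_cons.
Qed.

End SumOfIntegrals.

Section PairStatistic.
Context (d : measure_display) (Omega : measurableType d) (R : realType).
Variables (P : R -> probability Omega R) (X Y : nat -> {mfun Omega >-> R}).
Variable F : R -> R.
Hypothesis hmodel : two_sample_location P X Y F.
Local Notation mu2 := (pair_law (null_law P X)).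
Local Notation mu4 := (four_sample_law (null_law P X)).

Definition pair_statistic (phi : R -> R) (m n : nat) (w : Omega) : R :=
  \sum_(i < m) \sum_(j < n) phi (Y j w - X i w).

Variables (phi : R -> R) (B : R).
Hypothesis mphi : measurable_fun setT phi.
Hypothesis phiB : forall x, `|phi x| <= B.

Definition shifted_mean (t : R) : R := \int[mu2]_p phi (p.2 - p.1 + t).

Let measurable_pair i j : measurable_fun setT (fun w => phi (Y j w - X i w)).
Proof. by apply: measurableT_comp => //; exact: measurable_funB. Qed.

Lemma mean_pair_statistic m n t :
  mean P (pair_statistic phi m n) t = m%:R * n%:R * shifted_mean t.
Proof.
rewrite /mean unlock -[LHS]/(\int[P t]_w pair_statistic phi m n w).
have int_pair i j : (P t).-integrable setT (EFin \o (fun w => phi (Y j w - X i w))).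
  by apply: integrable_bounded (measurable_pair i j) _ => w; exact: phiB.
rewrite /pair_statistic Rintegral_sum; last first.
  by move=> i; exact: integrable_Rsum.
under eq_bigr => i _.
  rewrite Rintegral_sum//.
  under eq_bigr => j _ do rewrite (expectation_pair hmodel t i j mphi phiB).
  over.
rewrite !sumr_const !card_ord -mulrnA -[LHS]mulr_natl natrM.
by rewrite [n%:R * _]mulrC.
Qed.

Definition centered (z : R) : R := phi z - shifted_mean 0.

(** Covariances of two summands that share both observations, only the one from
    the first sample, or only the one from the second sample.  In the generic
    quadruple [((a, b), (c, d))], [a] and [b] stand for [X_i] and [Y_j], and [c]
    is the third observation. *)
Definition cov_same : R := \int[mu4]_x centered (x.1.2 - x.1.1) ^+ 2.

Definition cov_first : R :=
  \int[mu4]_x (centered (x.1.2 - x.1.1) * centered (x.2.1 - x.1.1)).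

Definition cov_second : R :=
  \int[mu4]_x (centered (x.1.2 - x.1.1) * centered (x.1.2 - x.2.1)).

Let C := B + `|shifted_mean 0|.

Let centered_le z : `|centered z| <= C.
Proof. by rewrite /centered (le_trans (ler_normB _ _))// lerD2r. Qed.

Let mcentered : measurable_fun setT centered.
Proof. exact: measurable_funB. Qed.

Let centered_mul_le y z : `|centered y * centered z| <= C * C.
Proof. by rewrite normrM ler_pM. Qed.

Let measurable_centered_difference d' (T : measurableType d') (u v : T -> R) :
  measurable_fun setT u -> measurable_fun setT v ->
  measurable_fun setT (fun x => centered (u x - v x)).
Proof. by move=> mu mv; apply: measurableT_comp => //; exact: measurable_funB. Qed.

Lemma integral_centered : \int[mu2]_p centered (p.2 - p.1) = 0.
Proof.
have I1 : mu2.-integrable setT (EFin \o (fun p : R * R => phi (p.2 - p.1))).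
  apply: (@integrable_bounded _ _ _ mu2 _ B) => //.
  by apply: measurableT_comp => //; exact: measurable_funB.
have I2 : mu2.-integrable setT (EFin \o (fun p : R * R => shifted_mean 0)).
  by apply: (@integrable_bounded _ _ _ mu2 _ `|shifted_mean 0|).
rewrite /centered RintegralB// Rintegral_cst//.
have -> : fine (mu2 setT) = 1 by rewrite probability_setT.
rewrite mulr1 /shifted_mean.
by under [X in _ - X]eq_Rintegral do rewrite addr0; rewrite subrr.
Qed.

(** Without a common observation the two centred factors are independent. *)
Lemma cov_disjoint :
  \int[mu4]_x (centered (x.1.2 - x.1.1) * centered (x.2.2 - x.2.1)) = 0.
Proof.
pose H (x : (R * R) * (R * R)) := centered (x.1.2 - x.1.1) * centered (x.2.2 - x.2.1).
have mH : measurable_fun setT H.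
  apply: measurable_funM; apply: measurable_centered_difference;
    exact: measurableT_comp.
have intH : mu4.-integrable setT (EFin \o H).
  by apply: (@integrable_bounded _ _ _ mu4 _ (C * C) mH) => x; exact: centered_mul_le.
rewrite -[LHS]/(\int[mu4]_x H x) {1}/Rintegral.
rewrite -(@integral12_prod_meas1 _ _ _ _ _ mu2 mu2 (EFin \o H) intH).
rewrite integral0_eq// => x _.
have I : mu2.-integrable setT
    (EFin \o (fun y : R * R => centered (x.2 - x.1) * centered (y.2 - y.1))).
  apply: (@integrable_bounded _ _ _ mu2 _ (C * C)) => [|y]; last exact: centered_mul_le.
  by apply: measurable_funM => //; exact: measurable_centered_difference.
rewrite -[LHS]fineK; last exact: integrable_fin_num I.
congr EFin; rewrite -[LHS]/(\int[mu2]_y (centered (x.2 - x.1) * centered (y.2 - y.1))).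
rewrite RintegralZl ?integral_centered ?mulr0//.
apply: (@integrable_bounded _ _ _ mu2 _ C) => //.
exact: measurable_centered_difference.
Qed.

(** The coefficient of the first term is chosen so that all four cases of index
    coincidence are covered by one formula, which can then be summed. *)
Lemma cov_pairs i j i' j' :
  \int[P 0]_w (centered (Y j w - X i w) * centered (Y j' w - X i' w)) =
  ((i == i') && (j == j'))%:R * (cov_same - cov_first - cov_second) +
  (i == i')%:R * cov_first + (j == j')%:R * cov_second.
Proof.
pose m1 : measurable_fun setT (fun x : (R * R) * (R * R) => x.1.1) :=
  measurableT_comp measurable_fst measurable_fst.
pose m2 : measurable_fun setT (fun x : (R * R) * (R * R) => x.1.2) :=
  measurableT_comp measurable_snd measurable_fst.
pose m3 : measurable_fun setT (fun x : (R * R) * (R * R) => x.2.1) :=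
  measurableT_comp measurable_fst measurable_snd.
pose m4 : measurable_fun setT (fun x : (R * R) * (R * R) => x.2.2) :=
  measurableT_comp measurable_snd measurable_snd.
(* The observations not involved are filled in with fresh indices. *)
have step i1 i2 i3 i4 (u v : (R * R) * (R * R) -> R) :
    uniq [:: i1; i2; i3; i4] ->
    measurable_fun setT (fun x => centered (u x)) ->
    measurable_fun setT (fun x => centered (v x)) ->
    \int[P 0]_w (centered (u (four_samples X Y i1 i2 i3 i4 w)) *
                 centered (v (four_samples X Y i1 i2 i3 i4 w))) =
    \int[mu4]_x (centered (u x) * centered (v x)).
  move=> uniq4 mu mv.
  apply: (expectation_four hmodel
    (H := fun x => centered (u x) * centered (v x)) (B := C * C)) => //.
  exact: measurable_funM.
have md (u v : (R * R) * (R * R) -> R) : measurable_fun setT u -> measurable_fun setT v ->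
    measurable_fun setT (fun x : (R * R) * (R * R) => centered (u x - v x)).
  exact: measurable_centered_difference.
have [<-|ii'] := eqVneq i i'; have [<-|jj'] := eqVneq j j' => /=.
- rewrite !(mulr1n, mul1r) addrAC !subrK.
  apply: (step (inl i) (inr j) (inl i.+1) (inr j.+1)
    (fun x => x.1.2 - x.1.1) (fun x => x.1.2 - x.1.1) _ (md _ _ m2 m1) (md _ _ m2 m1)).
  by rewrite /= !inE /eq_op /= !orbF ?(ltn_eqF (ltnSn _)).
- rewrite !(mulr1n, mulr0n, mul1r, mul0r, add0r, addr0).
  apply: (step (inl i) (inr j) (inr j') (inl i.+1)
    (fun x => x.1.2 - x.1.1) (fun x => x.2.1 - x.1.1) _ (md _ _ m2 m1) (md _ _ m3 m1)).
  by rewrite /= !inE /eq_op /= !orbF ?jj' ?(ltn_eqF (ltnSn _)).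
- rewrite !(mulr1n, mulr0n, mul1r, mul0r, add0r, addr0).
  apply: (step (inl i) (inr j) (inl i') (inr j.+1)
    (fun x => x.1.2 - x.1.1) (fun x => x.1.2 - x.2.1) _ (md _ _ m2 m1) (md _ _ m2 m3)).
  by rewrite /= !inE /eq_op /= !orbF ?ii' ?(ltn_eqF (ltnSn _)).
- rewrite !(mulr0n, mul0r, add0r, addr0); apply: etrans cov_disjoint.
  apply: (step (inl i) (inr j) (inl i') (inr j')
    (fun x => x.1.2 - x.1.1) (fun x => x.2.2 - x.2.1) _ (md _ _ m2 m1) (md _ _ m4 m3)).
  by rewrite /= !inE /eq_op /= !orbF ?ii' ?jj' ?(ltn_eqF (ltnSn _)).
Qed.

Lemma cov_pairs_uncentered i j i' j' :
  \int[P 0]_w (centered (Y j w - X i w) * centered (Y j' w - X i' w)) =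
  \int[P 0]_w (phi (Y j w - X i w) * phi (Y j' w - X i' w)) -
  shifted_mean 0 ^+ 2.
Proof.
set e := shifted_mean 0.
pose D i j w := phi (Y j w - X i w).
have B0 : 0 <= B := le_trans (normr_ge0 _) (phiB 0).
have ID k l : (P 0).-integrable setT (EFin \o D k l).
  apply: (@integrable_bounded _ _ _ (P 0) _ B) => [|w]; last exact: phiB.
  exact: measurable_pair.
have IDD : (P 0).-integrable setT (EFin \o (fun w => D i j w * D i' j' w)).
  apply: (@integrable_bounded _ _ _ (P 0) _ (B * B)).
    by apply: measurable_funM; exact: measurable_pair.
  by move=> w; rewrite normrM ler_pM// phiB.
have IeD k l : (P 0).-integrable setT (EFin \o (fun w => e * D k l w)).
  exact: (@integrableZl _ _ _ (P 0) _ _ e _ (ID k l)).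
have Iee : (P 0).-integrable setT (EFin \o (fun w => - e ^+ 2)).
  by apply: (@integrable_bounded _ _ _ (P 0) _ `|- e ^+ 2|).
have ED k l : \int[P 0]_w D k l w = e.
  exact: (expectation_pair hmodel 0 k l mphi phiB).
transitivity (\int[P 0]_w (D i j w * D i' j' w - (e * D i j w + e * D i' j' w - e ^+ 2))).
  by apply: eq_Rintegral => w _; rewrite /centered /D -/e; ring.
have I1 : (P 0).-integrable setT (EFin \o (fun w => e * D i j w + e * D i' j' w)).
  exact: (integrableD _ (IeD i j) (IeD i' j')).
have I2 : (P 0).-integrable setT
    (EFin \o (fun w => e * D i j w + e * D i' j' w - e ^+ 2)).
  exact: (integrableD _ I1 Iee).
rewrite RintegralB// RintegralD// RintegralD// !RintegralZl// !ED.
rewrite Rintegral_cst// (_ : fine (P 0 setT) = 1); last by rewrite probability_setT.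
by rewrite /D; ring.
Qed.

Lemma null_variance_pair_statistic m n :
  null_variance P (pair_statistic phi m n) =
  m%:R * n%:R * ((cov_same - cov_first - cov_second) +
                 n%:R * cov_first + m%:R * cov_second).
Proof.
have mE := mean_pair_statistic m n 0; rewrite /mean in mE.
rewrite /null_variance /variance unlock mE.
rewrite unlock -[LHS]/(\int[P 0]_w
  ((pair_statistic phi m n w - m%:R * n%:R * shifted_mean 0) *
   (pair_statistic phi m n w - m%:R * n%:R * shifted_mean 0))).
pose D i j w := centered (Y j w - X i w).
have mD i j : measurable_fun setT (D i j) by exact: measurable_centered_difference.
have ID i j i' j' : (P 0).-integrable setT (EFin \o (fun w => D i j w * D i' j' w)).
  apply: (@integrable_bounded _ _ _ (P 0) _ (C * C)); first exact: measurable_funM.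
  by move=> w; exact: centered_mul_le.
transitivity (\int[P 0]_w \sum_(i < m) \sum_(j < n) \sum_(i' < m) \sum_(j' < n)
    D i j w * D i' j' w).
  apply: eq_Rintegral => w _.
  have -> : pair_statistic phi m n w - m%:R * n%:R * shifted_mean 0 =
      \sum_(i < m) \sum_(j < n) D i j w.
    under [RHS]eq_bigr do rewrite sumrB sumr_const card_ord.
    rewrite sumrB sumr_const card_ord -!mulrnA -[_ *+ (n * m)]mulr_natl natrM.
    by rewrite [n%:R * _]mulrC.
  rewrite mulr_suml; apply: eq_bigr => i _.
  rewrite mulr_suml; apply: eq_bigr => j _.
  rewrite mulr_sumr; apply: eq_bigr => i' _.
  by rewrite mulr_sumr.
rewrite Rintegral_sum; last by move=> i; do 3 (apply: integrable_Rsum => ?); exact: ID.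
under eq_bigr => i _.
  rewrite Rintegral_sum; last by move=> j; do 2 (apply: integrable_Rsum => ?); exact: ID.
  under eq_bigr => j _.
    rewrite Rintegral_sum; last by move=> i'; apply: integrable_Rsum => ?; exact: ID.
    under eq_bigr => i' _.
      rewrite Rintegral_sum; last by move=> j'; exact: ID.
      under eq_bigr => j' _ do rewrite cov_pairs.
      over.
    over.
  over.
have sum1 l (a : 'I_l) c : \sum_(b < l) (a == b :> nat)%:R * c = c :> R.
  rewrite (bigD1 a)//= eqxx mul1r big1 ?addr0// => b nab.
  by rewrite eq_sym val_eqE (negbTE nab) mul0r.
set c0 := cov_same - _ - _.
transitivity (\sum_(i < m) \sum_(j < n) (c0 + n%:R * cov_first + m%:R * cov_second)).
  apply: eq_bigr => i _; apply: eq_bigr => j _.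
  transitivity (\sum_(i' < m)
    ((i == i' :> nat)%:R * (c0 + n%:R * cov_first) + cov_second)).
    apply: eq_bigr => i' _; rewrite !big_split/= sum1 sumr_const card_ord.
    congr (_ + _); rewrite mulrDr; congr (_ + _).
      rewrite -[RHS](sum1 _ j); apply: eq_bigr => j' _.
      by rewrite -mulnb natrM mulrA [_%:R * _%:R]mulrC.
    by rewrite -[LHS]mulr_natl mulrCA.
  by rewrite big_split/= sum1 sumr_const card_ord -[_ *+ m]mulr_natl.
by rewrite !sumr_const !card_ord -mulrnA -[LHS]mulr_natl natrM [n%:R * _]mulrC.
Qed.

End PairStatistic.

(** * Covariances of the Wilcoxon statistic *)
Section NullCovariances.
Context (d : measure_display) (Omega : measurableType d) (R : realType).
Variables (P : R -> probability Omega R) (X Y : nat -> {mfun Omega >-> R}).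
Variables (F f : R -> R).
Hypothesis hdens : has_density F f.
Hypothesis hmodel : two_sample_location P X Y F.
Local Notation Z := (pooled X Y).
Local Notation mu2 := (pair_law (null_law P X)).
Local Notation mu4 := (four_sample_law (null_law P X)).

Lemma ae_pair_neq : {ae mu2, forall p, p.2 - p.1 != 0}.
Proof.
have [mf f0 _] := hdens.
exact: ae_difference_neq0 mf f0 (null_law_ray hdens hmodel).
Qed.

(** Stated with four indices because null sets are transported along the joint
    law of four distinct observations. *)
Lemma ae_no_tie i1 i2 i3 i4 : uniq [:: i1; i2; i3; i4] ->
  {ae P 0, forall w, Z i2 w - Z i1 w != 0}.
Proof.
move=> u4; have [D [mD D0 Dsub]] := ae_pair_neq.
exists (four_samples X Y i1 i2 i3 i4 @^-1` (D `*` setT)); split.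
- rewrite -[X in measurable X]setTI.
  by apply: measurable_four_samples => //; exact: measurableX.
- rewrite (four_samples_joint_law hmodel u4); last exact: measurableX.
  rewrite [LHS](@product_measure1E _ _ _ _ _ mu2 mu2 D setT)//.
  by apply: (etrans _ (mul0e _)); congr (_ * _)%E; exact: D0.
- move=> w /= nw; split => //=; apply: Dsub => /=; exact: nw.
Qed.

Lemma psi_add_psiN (z : R) : z != 0 -> psi z + psi (- z) = 1.
Proof.
rewrite /psi oppr_ge0; case: (ltgtP z 0) => // _ _.
  by rewrite add0r.
by rewrite addr0.
Qed.

Let mpsi := @measurable_psi R.

Let mdiff i j : measurable_fun setT (fun w => psi (Z i w - Z j w) : R).
Proof. by apply: measurableT_comp => //; exact: measurable_funB. Qed.

Let mpsid d' (T : measurableType d') (u v : T -> R) :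
  measurable_fun setT u -> measurable_fun setT v ->
  measurable_fun setT (fun x => psi (u x - v x) : R).
Proof. by move=> mu mv; apply: measurableT_comp => //; exact: measurable_funB. Qed.

Lemma psi_mul_norm (x y : R) : `|psi x * psi y| <= 1.
Proof. by rewrite normrM mulr_ile1 ?psi_norm_le1. Qed.

Lemma four_expectation_perm (u v : (R * R) * (R * R) -> R) i1 i2 i3 i4 j1 j2 j3 j4 :
  measurable_fun setT (fun x => psi (u x) : R) ->
  measurable_fun setT (fun x => psi (v x) : R) ->
  uniq [:: i1; i2; i3; i4] -> uniq [:: j1; j2; j3; j4] ->
  \int[P 0]_w (psi (u (four_samples X Y i1 i2 i3 i4 w)) *
    psi (v (four_samples X Y i1 i2 i3 i4 w))) =
  \int[P 0]_w (psi (u (four_samples X Y j1 j2 j3 j4 w)) *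
    psi (v (four_samples X Y j1 j2 j3 j4 w))).
Proof.
move=> mu mv ui uj.
pose H x := psi (u x) * psi (v x) : R.
have mH : measurable_fun setT H by exact: measurable_funM.
have H1 x : `|H x| <= 1 by exact: psi_mul_norm.
rewrite -[LHS]/(\int[P 0]_w H (four_samples X Y i1 i2 i3 i4 w)).
by rewrite (expectation_four hmodel ui mH H1) -(expectation_four hmodel uj mH H1).
Qed.

Let u4 : uniq [:: inl 0; inr 0; inr 1; inl 1 : nat + nat]. Proof. by []. Qed.

(** By exchangeability [X_0 <= Y_0] and [Y_0 <= X_0] are equally likely, and
    ties have probability 0. *)
Lemma shifted_mean_psi_le : shifted_mean P X (@psi R) 0 <= 2^-1.
Proof.
have E : shifted_mean P X (@psi R) 0 = \int[P 0]_w psi (Y 0 w - X 0 w).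
  by rewrite (expectation_pair hmodel 0 0 0 mpsi (@psi_norm_le1 R)).
have I i j : (P 0).-integrable setT (EFin \o (fun w => psi (Z i w - Z j w))).
  apply: (@integrable_bounded _ _ _ (P 0) _ 1) => [|w]; first exact: mdiff.
  exact: psi_norm_le1.
have E' : \int[P 0]_w psi (X 0 w - Y 0 w) = shifted_mean P X (@psi R) 0.
  pose H (x : (R * R) * (R * R)) : R := psi (x.1.2 - x.1.1).
  have mH : measurable_fun setT H by apply: mpsid; exact: measurableT_comp.
  have H1 x : `|H x| <= 1 by exact: psi_norm_le1.
  rewrite E -[RHS]/(\int[P 0]_w H (four_samples X Y (inl 0) (inr 0) (inr 1) (inl 1) w)).
  rewrite (expectation_four hmodel u4 mH H1).
  have u4' : uniq [:: inr 0; inl 0; inr 1; inl 1 : nat + nat] by [].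
  by rewrite -(expectation_four hmodel u4' mH H1).
suff : shifted_mean P X (@psi R) 0 + shifted_mean P X (@psi R) 0 = 1 by lra.
rewrite {1}E -E' -RintegralD//; [|exact: (I (inr 0) (inl 0))|exact: (I (inl 0) (inr 0))].
transitivity (\int[P 0]_w (1 : R)); last first.
  by rewrite Rintegral_cst// mul1r (_ : fine (P 0 setT) = 1)// probability_setT.
congr fine; apply: ae_eq_integral => //.
- apply/measurable_EFinP/measurable_funD; first exact: (mdiff (inr 0) (inl 0)).
  exact: (mdiff (inl 0) (inr 0)).
- have := ae_no_tie u4; apply: filterS => w /= nw _.
  by rewrite -(opprB (Y 0 w)) psi_add_psiN.
Qed.

Lemma shifted_mean_psi_ge0 : 0 <= shifted_mean P X (@psi R) 0.
Proof. by apply: Rintegral_ge0 => p _; exact: psi_ge0. Qed.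

Lemma psi_covering (a b c : R) :
  1 <= psi (b - a) * psi (c - a) + psi (a - b) * psi (c - b) +
       psi (a - c) * psi (b - c).
Proof.
have psi1 (x y : R) : x <= y -> psi (y - x) = 1.
  by rewrite /psi subr_ge0 => ->.
have p0 (x y : R) : 0 <= psi x * psi y by rewrite mulr_ge0 ?psi_ge0.
have := p0 (b - a) (c - a); have := p0 (a - b) (c - b); have := p0 (a - c) (b - c).
have [ab|/ltW ba] := leP a b; have [bc|/ltW cb] := leP b c.
- rewrite (psi1 _ _ ab) (psi1 _ _ (le_trans ab bc)); lra.
- have [ac|/ltW ca] := leP a c; first by rewrite (psi1 _ _ ab) (psi1 _ _ ac); lra.
  by rewrite (psi1 _ _ ca) (psi1 _ _ cb); lra.
- rewrite (psi1 _ _ ba) (psi1 _ _ bc); lra.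
- rewrite (psi1 _ _ cb) (psi1 _ _ (le_trans cb ba)); lra.
Qed.

(** For [s = 1] the integral is the probability that the first of three
    exchangeable observations is the smallest, for [s = -1] that it is the
    largest.  One of the three is always extremal, so three times this
    probability is at least 1. *)
Lemma extremal_probability_ge (s : R) i1 i2 i3 i4 : uniq [:: i1; i2; i3; i4] ->
  1 <= 3 * \int[P 0]_w (psi (s * (Z i2 w - Z i1 w)) * psi (s * (Z i3 w - Z i1 w))).
Proof.
move=> u1.
have u2 : uniq [:: i2; i1; i3; i4].
  by rewrite (perm_uniq (s2 := [:: i1; i2; i3; i4]))// (perm_catCA [:: i2] [:: i1]).
have u3 : uniq [:: i3; i1; i2; i4].
  rewrite (perm_uniq (s2 := [:: i1; i2; i3; i4]))// (perm_catCA [:: i3] [:: i1; i2]) //.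
pose u (x : (R * R) * (R * R)) := s * (x.1.2 - x.1.1).
pose v (x : (R * R) * (R * R)) := s * (x.2.1 - x.1.1).
have mu : measurable_fun setT (fun x => psi (u x) : R).
  apply: measurableT_comp => //; apply: measurable_funM => //.
  by apply: measurable_funB; exact: measurableT_comp.
have mv : measurable_fun setT (fun x => psi (v x) : R).
  apply: measurableT_comp => //; apply: measurable_funM => //.
  by apply: measurable_funB; exact: measurableT_comp.
have E2 := four_expectation_perm mu mv u2 u1.
have E3 := four_expectation_perm mu mv u3 u1.
set p := \int[P 0]_w _.
have Ip j1 j2 j3 j4 : (P 0).-integrable setT (EFin \o (fun w =>
    psi (u (four_samples X Y j1 j2 j3 j4 w)) * psi (v (four_samples X Y j1 j2 j3 j4 w)))).
  apply: (@integrable_bounded _ _ _ (P 0) _ 1) => [|w]; last exact: psi_mul_norm.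
  have m4 := measurable_four_samples X Y j1 j2 j3 j4.
  exact: measurable_funM (measurableT_comp mu m4) (measurableT_comp mv m4).
have -> : 3 * p = p + p + p by ring.
rewrite -[X in p + X + _](E2 : _ = p) -[X in _ + _ + X](E3 : _ = p) /p.
rewrite -RintegralD//; last exact: (Ip i1 i2 i3 i4).
rewrite -RintegralD//; last first.
  exact: (integrableD _ (Ip i1 i2 i3 i4) (Ip i2 i1 i3 i4)).
  have -> : 1 = \int[P 0]_w (1 : R).
    by rewrite Rintegral_cst// mul1r (_ : fine (P 0 setT) = 1)// probability_setT.
  apply: le_Rintegral => //.
  - by apply: (@integrable_bounded _ _ _ (P 0) _ `|1|).
  - have I12 := integrableD measurableT (Ip i1 i2 i3 i4) (Ip i2 i1 i3 i4).
    exact: (integrableD _ I12 (Ip i3 i1 i2 i4)).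
  - by move=> w _; rewrite /u /v /= !mulrBr; exact: psi_covering.
Qed.

(** The covariance is at least 1/3 - (1/2)^2. *)
Lemma cov_first_psi_gt0 : 0 < cov_first P X (@psi R).
Proof.
have := cov_pairs hmodel mpsi (@psi_norm_le1 R) 0 0 0 1.
rewrite (cov_pairs_uncentered hmodel mpsi (@psi_norm_le1 R)) /=.
rewrite !(mulr1n, mulr0n, mul1r, mul0r, add0r, addr0) => <-.
have := extremal_probability_ge 1 u4; under eq_Rintegral do rewrite !mul1r.
rewrite /=; set p := \int[P 0]_w _ => p3.
have := shifted_mean_psi_le; have := shifted_mean_psi_ge0.
set e := shifted_mean _ _ _ _ => e0 e2.
have : e ^+ 2 <= 4^-1 by nra.
lra.
Qed.

Lemma cov_second_psi_gt0 : 0 < cov_second P X (@psi R).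
Proof.
have := cov_pairs hmodel mpsi (@psi_norm_le1 R) 0 0 1 0.
rewrite (cov_pairs_uncentered hmodel mpsi (@psi_norm_le1 R)) /=.
rewrite !(mulr1n, mulr0n, mul1r, mul0r, add0r, addr0) => <-.
have u4' : uniq [:: inr 0; inl 0; inl 1; inr 1 : nat + nat] by [].
have := extremal_probability_ge (-1) u4'.
under eq_Rintegral do rewrite !mulN1r !opprB.
rewrite /=; set p := \int[P 0]_w _ => p3.
have := shifted_mean_psi_le; have := shifted_mean_psi_ge0.
set e := shifted_mean _ _ _ _ => e0 e2.
have : e ^+ 2 <= 4^-1 by nra.
lra.
Qed.

End NullCovariances.

(** * Limit of the Pitman sequence *)
Section PitmanLimit.
Context (d : measure_display) (Omega : measurableType d) (R : realType).
Variables (P : R -> probability Omega R) (X Y : nat -> {mfun Omega >-> R}).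
Variables (F f : R -> R).
Hypothesis hdens : has_density F f.
Hypothesis hmodel : two_sample_location P X Y F.

Variables (phi_ : nat -> R -> R) (B : R).
Hypothesis mphi : forall N, measurable_fun setT (phi_ N).
Hypothesis phiB : forall N x, `|phi_ N x| <= B.
Hypothesis phi_psi : forall z, z != 0 -> phi_ N z @[N --> \oo] --> psi z.

Local Notation e := (fun phi => shifted_mean P X phi 0).
Local Notation prod_mean phi i j i' j' :=
  (\int[P 0]_w (phi (Y j w - X i w) * phi (Y j' w - X i' w))).

Let mpair i j phi : measurable_fun setT phi ->
  measurable_fun setT (fun w => phi (Y j w - X i w) : R).
Proof. by move=> mp; apply: measurableT_comp => //; exact: measurable_funB. Qed.

Lemma ae_pair_cvg i j :
  {ae P 0, forall w, phi_ N (Y j w - X i w) @[N --> \oo] --> psi (Y j w - X i w)}.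
Proof.
have u : uniq [:: inl i; inr j; inl i.+1; inr j.+1 : nat + nat].
  by rewrite /= !inE /eq_op /= !orbF ?(ltn_eqF (ltnSn _)).
have := ae_no_tie hdens hmodel u; apply: filterS => w nw.
exact: phi_psi.
Qed.

Lemma shifted_mean_cvg : e (phi_ N) @[N --> \oo] --> e (@psi R).
Proof.
have mpsi := @measurable_psi R.
have Epsi : \int[P 0]_w psi (Y 0 w - X 0 w) = e (@psi R).
  by rewrite (expectation_pair hmodel 0 0 0 mpsi (@psi_norm_le1 R)).
have E N : \int[P 0]_w phi_ N (Y 0 w - X 0 w) = e (phi_ N).
  by rewrite (expectation_pair hmodel 0 0 0 (mphi N) (phiB N)).
rewrite -Epsi; under eq_fun do rewrite -E.
apply: (@dominated_cvg_Rintegral _ _ _ (P 0) _ _ (fun=> B)).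
- by move=> N; exact: mpair.
- exact: mpair.
- exact: ae_pair_cvg.
- by apply: (@integrable_bounded _ _ _ (P 0) _ `|B|).
- by move=> N w; exact: phiB.
Qed.

Lemma prod_mean_cvg i j i' j' :
  prod_mean (phi_ N) i j i' j' @[N --> \oo] --> prod_mean (@psi R) i j i' j'.
Proof.
have mpsi := @measurable_psi R.
apply: (@dominated_cvg_Rintegral _ _ _ (P 0) _ _ (fun=> B * B)).
- by move=> N; apply: measurable_funM; exact: mpair.
- by apply: measurable_funM; exact: mpair.
- have := ae_pair_cvg i' j'; have := ae_pair_cvg i j; apply: filterS2 => w c1 c2.
  exact: cvgM.
- by apply: (@integrable_bounded _ _ _ (P 0) _ `|B * B|).
- by move=> N w; rewrite normrM ler_pM.
Qed.

(** The indices select two summands that share both, the first, or the second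
    observation; products of summands, unlike centred ones, have a limit by
    dominated convergence directly. *)
Lemma covariances_from_products (phi : R -> R) (C : R) :
  measurable_fun setT phi -> (forall x, `|phi x| <= C) ->
  [/\ cov_same P X phi = prod_mean phi 0 0 0 0 - e phi ^+ 2,
      cov_first P X phi = prod_mean phi 0 0 0 1 - e phi ^+ 2 &
      cov_second P X phi = prod_mean phi 0 0 1 0 - e phi ^+ 2].
Proof.
move=> mp pC; split; rewrite -(cov_pairs_uncentered hmodel mp pC)
  (cov_pairs hmodel mp pC) /= !(mulr1n, mulr0n, mul1r, mul0r, add0r, addr0)//.
by rewrite addrAC !subrK.
Qed.

Lemma covariances_cvg :
  [/\ cov_same P X (phi_ N) @[N --> \oo] --> cov_same P X (@psi R),
      cov_first P X (phi_ N) @[N --> \oo] --> cov_first P X (@psi R) &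
      cov_second P X (phi_ N) @[N --> \oo] --> cov_second P X (@psi R)].
Proof.
have [-> -> ->] := covariances_from_products (@measurable_psi R) (@psi_norm_le1 R).
have E N := covariances_from_products (mphi N) (phiB N).
have ecvg : e (phi_ N) ^+ 2 @[N --> \oo] --> e (@psi R) ^+ 2.
  by under eq_fun do rewrite expr2; rewrite expr2; apply: cvgM; exact: shifted_mean_cvg.
split.
- have : prod_mean (phi_ N) 0 0 0 0 - e (phi_ N) ^+ 2 @[N --> \oo] -->
      prod_mean (@psi R) 0 0 0 0 - e (@psi R) ^+ 2.
    by apply: cvgB => //; exact: prod_mean_cvg.
  apply: cvg_trans; apply: near_eq_cvg; apply: nearW => N.
  by have [-> _ _] := E N.
- have : prod_mean (phi_ N) 0 0 0 1 - e (phi_ N) ^+ 2 @[N --> \oo] -->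
      prod_mean (@psi R) 0 0 0 1 - e (@psi R) ^+ 2.
    by apply: cvgB => //; exact: prod_mean_cvg.
  apply: cvg_trans; apply: near_eq_cvg; apply: nearW => N.
  by have [_ -> _] := E N.
- have : prod_mean (phi_ N) 0 0 1 0 - e (phi_ N) ^+ 2 @[N --> \oo] -->
      prod_mean (@psi R) 0 0 1 0 - e (@psi R) ^+ 2.
    by apply: cvgB => //; exact: prod_mean_cvg.
  apply: cvg_trans; apply: near_eq_cvg; apply: nearW => N.
  by have [_ _ ->] := E N.
Qed.

Variables (m n : nat -> nat) (la : R).
Hypothesis hN : forall N, (m N + n N)%N = N.
Hypothesis hla : (m N)%:R / N%:R @[N --> \oo] --> la.
Hypothesis hla01 : 0 < la < 1.

Lemma second_fraction_cvg : (n N)%:R / N%:R @[N --> \oo] --> 1 - la.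
Proof.
have : 1 - (m N)%:R / N%:R @[N --> \oo] --> 1 - la.
  by apply: cvgB => //; exact: cvg_cst.
apply: cvg_trans; apply: near_eq_cvg; near=> N.
have N0 : (N%:R : R) != 0 by rewrite pnatr_eq0 -lt0n; near: N; exact: nbhs_infty_gt.
have NE : N%:R = (m N)%:R + (n N)%:R :> R by rewrite -natrD hN.
by rewrite NE in N0 *; field.
Unshelve. all: by end_near. Qed.

(** The limit of the null variance divided by [N ^ 3], see
    [null_variance_cvg]. *)
Definition limit_variance : R :=
  la * (1 - la) * ((1 - la) * cov_first P X (@psi R) + la * cov_second P X (@psi R)).

Lemma limit_variance_gt0 : 0 < limit_variance.
Proof.
have /andP[l0 l1] := hla01.
have c1 := cov_first_psi_gt0 hdens hmodel.
have c2 := cov_second_psi_gt0 hdens hmodel.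
have l1' : 0 < 1 - la by rewrite subr_gt0.
by rewrite /limit_variance mulr_gt0 ?addr_gt0// mulr_gt0.
Qed.

Lemma null_variance_cvg :
  null_variance P (pair_statistic X Y (phi_ N) (m N) (n N)) / N%:R ^+ 3
    @[N --> \oo] --> limit_variance.
Proof.
have [cs c1 c2] := covariances_cvg.
have hn := second_fraction_cvg.
have Ninv : (N%:R^-1 : R) @[N --> \oo] --> 0.
  rewrite gtr0_cvgV0; first exact: cvgr_idn.
  by near=> N; rewrite ltr0n; near: N; exact: nbhs_infty_gt.
have : (m N)%:R / N%:R * ((n N)%:R / N%:R) *
   (N%:R^-1 * (cov_same P X (phi_ N) - cov_first P X (phi_ N) - cov_second P X (phi_ N))
    + (n N)%:R / N%:R * cov_first P X (phi_ N)
    + (m N)%:R / N%:R * cov_second P X (phi_ N))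
  @[N --> \oo] --> la * (1 - la) * (0 * (cov_same P X (@psi R) - cov_first P X (@psi R)
     - cov_second P X (@psi R)) + (1 - la) * cov_first P X (@psi R) +
     la * cov_second P X (@psi R)).
  apply: (cvgM (cvgM hla hn)).
  apply: cvgD; last exact: cvgM hla c2.
  apply: cvgD; last exact: cvgM hn c1.
  by apply: (cvgM Ninv); apply: cvgB => //; exact: cvgB.
rewrite mul0r add0r; apply: cvg_trans; apply: near_eq_cvg; near=> N.
have N0 : (N%:R : R) != 0 by rewrite pnatr_eq0 -lt0n; near: N; exact: nbhs_infty_gt.
rewrite (null_variance_pair_statistic hmodel (mphi N) (phiB N)).
by field.
Unshelve. all: by end_near. Qed.

Variables (gamma : R).
Hypothesis dmean : \forall N \near \oo, derivable (shifted_mean P X (phi_ N)) 0 1.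
Hypothesis dmean_cvg : derive1 (shifted_mean P X (phi_ N)) 0 @[N --> \oo] --> gamma.

Definition common_efficiency : R :=
  limit_variance `^ (- 2^-1) * (la * (1 - la) * gamma).

(** [(N V) ^ (-1/2) * m n D] is rewritten as
    [(V / N ^ 3) ^ (-1/2) * (m / N) (n / N) D], each factor of which
    converges. *)
Lemma pitman_limit :
  let T := fun N => pair_statistic X Y (phi_ N) (m N) (n N) in
  (\forall N \near \oo, derivable (mean P (T N)) 0 1) /\
  pitman_seq P T @ \oo --> common_efficiency.
Proof.
move=> T.
have meanE N : mean P (T N) =
    (fun t => (m N)%:R * (n N)%:R * shifted_mean P X (phi_ N) t).
  by apply/funext => t; rewrite (mean_pair_statistic hmodel (mphi N) (phiB N)).
have dT N : derivable (shifted_mean P X (phi_ N)) 0 1 ->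
    derivable (mean P (T N)) 0 1 /\ derive1 (mean P (T N)) 0 =
      (m N)%:R * (n N)%:R * derive1 (shifted_mean P X (phi_ N)) 0.
  move=> dN; apply/derivable_derive1P.
  have /derivable_derive1P : derivable (shifted_mean P X (phi_ N)) 0 1 /\
    derive1 (shifted_mean P X (phi_ N)) 0 = derive1 (shifted_mean P X (phi_ N)) 0.
    by [].
  move=> /(cvgM (cvg_cst ((m N)%:R * (n N)%:R : R))); apply: cvg_trans.
  apply: near_eq_cvg; apply: nearW => x /=.
  by rewrite meanE -mulrBr mulrCA.
split; first by apply: filterS dmean => N /dT[].
have hn := second_fraction_cvg.
have : (null_variance P (T N) / N%:R ^+ 3) `^ (- 2^-1) *
  ((m N)%:R / N%:R * ((n N)%:R / N%:R) * derive1 (shifted_mean P X (phi_ N)) 0)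
  @[N --> \oo] --> common_efficiency.
  apply: cvgM.
    have c : {for limit_variance, continuous (fun v : R => v `^ (- 2^-1))}.
      apply: differentiable_continuous; apply/derivable1_diffP; apply: derivable_powR.
      by rewrite in_itv/= limit_variance_gt0.
    exact: (cvg_comp _ _ null_variance_cvg c).
  by apply: cvgM => //; exact: cvgM.
apply: cvg_trans; apply: near_eq_cvg.
have vpos : \forall N \near \oo, 0 < null_variance P (T N) / N%:R ^+ 3.
  by move/cvgr_gt : null_variance_cvg; apply; exact: limit_variance_gt0.
near=> N.
have N0 : (0 < N%:R :> R) by rewrite ltr0n; near: N; exact: nbhs_infty_gt.
have [_ dE] : derivable (mean P (T N)) 0 1 /\ derive1 (mean P (T N)) 0 =
    (m N)%:R * (n N)%:R * derive1 (shifted_mean P X (phi_ N)) 0.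
  by apply: dT; near: N.
have V0 : 0 < null_variance P (T N) / N%:R ^+ 3 by near: N.
rewrite /pitman_seq dE.
set V := null_variance _ _ in V0 *.
have -> : N%:R * V = N%:R ^+ 4 * (V / N%:R ^+ 3) :> R.
  by field; rewrite gt_eqF.
rewrite (@powRM _ (N%:R ^+ 4)) ?exprn_ge0 ?(ltW V0)// ?(ltW N0)//.
have -> : (N%:R ^+ 4 : R) `^ (- 2^-1) = (N%:R ^+ 2)^-1.
  rewrite powRN powR12_sqrt ?exprn_ge0 ?(ltW N0)//.
  by rewrite (exprM _ 2 2) sqrtr_sqr ger0_norm ?exprn_ge0 ?(ltW N0).
by field; rewrite gt_eqF.
Unshelve. all: by end_near. Qed.

End PitmanLimit.

(** * The Wilcoxon statistic and its smoothed version *)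
Section WilcoxonEfficiency.
Context (d : measure_display) (Omega : measurableType d) (R : realType).
Variables (P : R -> probability Omega R) (X Y : nat -> {mfun Omega >-> R}).
Variables (F f : R -> R).
Notation lambda := (@lebesgue_measure R).
Hypothesis hdens : has_density F f.
Hypothesis hmodel : two_sample_location P X Y F.

Let mf : measurable_fun setT f. Proof. by have [] := hdens. Qed.
Let f0 x : 0 <= f x. Proof. by have [_ ->] := hdens. Qed.
Let ray := null_law_ray hdens hmodel.
Let intf : lambda.-integrable setT (EFin \o f).
Proof. exact: (integrable_density mf f0 ray). Qed.

Lemma shifted_mean_psi t : shifted_mean P X (@psi R) t = difference_cdf f t.
Proof. exact: (integral_psi_difference mf f0 ray). Qed.

Lemma difference_cdf_norm_le1 t : `|difference_cdf f t| <= 1.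
Proof.
rewrite -shifted_mean_psi /shifted_mean.
have I : (pair_law (null_law P X)).-integrable setT
    (EFin \o (fun p : R * R => psi (p.2 - p.1 + t))).
  apply: (@integrable_bounded _ _ _ (pair_law (null_law P X)) _ 1) => [|p];
    last exact: psi_norm_le1.
  exact: measurable_psi_difference.
apply: le_trans (le_normr_Rintegral measurableT I) _.
have -> : 1 = \int[pair_law (null_law P X)]_p (1 : R).
  rewrite Rintegral_cst// (_ : fine (pair_law (null_law P X) setT) = 1) ?mul1r//.
  by rewrite probability_setT.
apply: le_Rintegral => //.
- exact: integrable_norm.
- by apply: (@integrable_bounded _ _ _ (pair_law (null_law P X)) _ `|1|).
- by move=> p _; exact: psi_norm_le1.
Qed.

(** The difference quotients along [1 / (n + 1)] converge to a finite
    derivative, which bounds the integral of [f ^ 2] by Fatou's lemma. *)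
Lemma sqr_integrable_of_derivable : derivable (difference_cdf f) 0 1 ->
  lambda.-integrable setT (EFin \o (fun x => f x ^+ 2)).
Proof.
move=> dS.
have : derivable (difference_cdf f) 0 1 /\
  derive1 (difference_cdf f) 0 = derive1 (difference_cdf f) 0 by [].
move=> /derivable_derive1P/cvgr_dnbhsP dSn.
pose t n : R := n.+1%:R^-1.
have t0 n : 0 < t n by rewrite invr_gt0 ltr0n.
have tcvg : t @ \oo --> 0 by exact: cvg_harmonic.
pose D n := ((difference_cdf f (t n) - difference_cdf f 0) / t n)%:E.
have Dcvg : D @ \oo --> (derive1 (difference_cdf f) 0)%:E.
  apply/fine_cvgP; split; first exact: nearW.
  have tn : (forall n, t n != 0) /\ t @ \oo --> 0.
    by split=> // n; exact: lt0r_neq0.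
  apply: cvg_trans (dSn t tn); apply: near_eq_cvg; apply: nearW => n.
  by rewrite /D /= addr0 [RHS]mulrC.
have := sqr_integral_le_limn_einf mf f0 intf t0 tcvg.
rewrite -/D (cvg_limn_einf_sup Dcvg).1.
move=> le; apply/integrableP; split.
  by apply/measurable_EFinP; exact: measurable_funX.
apply: le_lt_trans (ltry (derive1 (difference_cdf f) 0)).
by apply: le_trans le; under eq_integral do rewrite /= ger0_norm ?sqr_ge0//.
Qed.

Variables (m n : nat -> nat) (la : R) (k : R -> R) (h : nat -> R).
Hypothesis hN : forall N, (m N + n N)%N = N.
Hypothesis hla : (m N)%:R / N%:R @[N --> \oo] --> la.
Hypothesis hla01 : 0 < la < 1.
Hypothesis intk : lambda.-integrable setT (EFin \o k).
Hypothesis k1 : \int[lambda]_t k t = 1.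
Hypothesis h_gt0 : forall N, 0 < h N.
Hypothesis h_cvg0 : h @ \oo --> (0 : R).
Let W2 N := wilcoxon X Y (m N) (n N).
Let smoothedW2 N := smoothed_wilcoxon X Y k (h N) (m N) (n N).

(** For large [N] both samples are nonempty, and [S] is the mean of the
    statistic divided by the nonzero number of pairs. *)
Lemma derivable_of_wilcoxon : has_pitman_efficiency P W2 ->
  derivable (difference_cdf f) 0 1.
Proof.
move=> [dW _].
have /andP[la0 la1] := hla01.
have m_gt0 : \forall N \near \oo, 0 < (m N)%:R / N%:R :> R.
  by move/cvgr_gt : hla; apply.
have n_gt0 : \forall N \near \oo, 0 < (n N)%:R / N%:R :> R.
  by move/cvgr_gt : (second_fraction_cvg hN hla); apply; rewrite subr_gt0.
near \oo => N.
have : 0 < (m N)%:R / N%:R :> R by near: N.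
have : 0 < (n N)%:R / N%:R :> R by near: N.
have : derivable (mean P (W2 N)) 0 1 by near: N.
have -> : mean P (W2 N) = (fun t => (m N)%:R * (n N)%:R * difference_cdf f t).
  apply/funext => t; rewrite -shifted_mean_psi.
  exact: (mean_pair_statistic hmodel (@measurable_psi R) (@psi_norm_le1 R)).
set c := _ * _ => dc nN mN.
have c0 : c != 0.
  rewrite mulf_neq0//; first by apply: contraTneq mN => ->; rewrite mul0r ltxx.
  by apply: contraTneq nN => ->; rewrite mul0r ltxx.
have -> : difference_cdf f = (fun t => c^-1 * (c * difference_cdf f t)).
  by apply/funext => t; rewrite mulKf.
exact: derivableM.
Unshelve. all: by end_near. Qed.

Hypothesis sqf : lambda.-integrable setT (EFin \o (fun x => f x ^+ 2)).

Let gamma := autocorrelation f 0.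

Let dS t : derivable (difference_cdf f) t 1 /\
  derive1 (difference_cdf f) t = autocorrelation f t.
Proof. exact: derivable_difference_cdf. Qed.

Lemma wilcoxon_pitman_limit :
  (\forall N \near \oo, derivable (mean P (W2 N)) 0 1) /\
  pitman_seq P W2 @ \oo --> common_efficiency P X la gamma.
Proof.
have E : shifted_mean P X (@psi R) = difference_cdf f.
  by apply/funext => t; exact: shifted_mean_psi.
apply: (@pitman_limit _ _ _ P X Y F f hdens hmodel (fun=> @psi R) 1 _ _ _
  m n la hN hla hla01).
- by move=> _; exact: measurable_psi.
- by move=> _ x; exact: psi_norm_le1.
- by move=> z _; exact: cvg_cst.
- by rewrite E; apply: nearW => _; have [] := dS 0.
- by rewrite E (dS 0).2; exact: cvg_cst.
Qed.

Lemma smoothed_wilcoxon_pitman_limit :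
  (\forall N \near \oo, derivable (mean P (smoothedW2 N)) 0 1) /\
  pitman_seq P smoothedW2 @ \oo --> common_efficiency P X la gamma.
Proof.
have E N : shifted_mean P X (fun z => kernel_cdf k (z / h N)) =
    (fun t => \int[lambda]_u (k u * difference_cdf f (t - h N * u))).
  apply/funext => t; rewrite /shifted_mean integral_kernel_cdf//; last first.
    by apply: measurable_funB.
  by apply: eq_Rintegral => u _; rewrite -shifted_mean_psi.
have g0 := autocorrelation_ge0 f0.
have SM t : `|difference_cdf f t| <= 1 + autocorrelation f 0.
  by rewrite (le_trans (difference_cdf_norm_le1 t))// lerDl.
have gM t : `|autocorrelation f t| <= 1 + autocorrelation f 0.
  rewrite ger0_norm// (le_trans (autocorrelation_le mf f0 sqf t))//.
  by rewrite lerDr.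
have mg := measurable_autocorrelation mf f0 sqf.
have dSm N := derivable_smoothed intk dS SM gM (h N).
apply: (@pitman_limit _ _ _ P X Y F f hdens hmodel
  (fun N z => kernel_cdf k (z / h N)) (\int[lambda]_u `|k u|) _ _ _
  m n la hN hla hla01).
- move=> N; apply: measurableT_comp; first exact: measurable_kernel_cdf.
  exact: measurable_funM.
- by move=> N z; exact: kernel_cdf_bounded.
- by move=> z z0; exact: kernel_cdf_cvg_psi.
- by apply: nearW => N; rewrite E; have [] := dSm N.
- have cg : {for 0, continuous (autocorrelation f)} by exact: continuous_autocorrelation.
  have := smoothed_derivative_cvg intk gM mg h_cvg0 cg.
  rewrite k1 mul1r; apply: cvg_trans; apply: near_eq_cvg; apply: nearW => N.
  by rewrite E (dSm N).2.
Qed.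

Lemma wilcoxon_efficiencies :
  has_pitman_efficiency P W2 /\ has_pitman_efficiency P smoothedW2 /\
  pitman_efficiency P smoothedW2 = pitman_efficiency P W2.
Proof.
have [dW cW] := wilcoxon_pitman_limit.
have [dS2 cS2] := smoothed_wilcoxon_pitman_limit.
split; first by split => //; apply/cvg_ex; eexists; exact: cW.
split; first by split => //; apply/cvg_ex; eexists; exact: cS2.
by rewrite /pitman_efficiency (cvg_lim _ cW) ?(cvg_lim _ cS2).
Qed.

End WilcoxonEfficiency.

Theorem theorem4 (R : realType) (d : measure_display)
    (Omega : measurableType d) (P : R -> probability Omega R)
    (X Y : nat -> {mfun Omega >-> R}) (F f : R -> R)
    (m n : nat -> nat) (lambda theta : R) (k : R -> R) (h : nat -> R)
    (hdens : has_density F f)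
    (hmodel : two_sample_location P X Y F)
    (hN : forall N, (m N + n N)%N = N)
    (hlambda : (m N)%:R / N%:R @[N --> \oo] --> lambda)
    (hlambda01 : 0 < lambda < 1)
    (hk : symmetric_kernel k)
    (hh_gt0 : forall N, 0 < h N)
    (hh_to0 : h @ \oo --> (0 : R))
    (hh : bandwidth_condition k h)
    (htheta : 0 <= theta)
    (hf0 : C1_near f 0)
    (hftheta : C1_near f theta) :
  let W2 := fun N => wilcoxon X Y (m N) (n N) in
  let smoothedW2 := fun N => smoothed_wilcoxon X Y k (h N) (m N) (n N) in
  (lebesgue_measure.-integrable setT (EFin \o (fun x => f x ^+ 2)) ->
     has_pitman_efficiency P W2) /\
  (has_pitman_efficiency P W2 ->
     has_pitman_efficiency P smoothedW2 /\
     pitman_efficiency P smoothedW2 = pitman_efficiency P W2).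
Proof.
have [intk _ k1] := hk.
split=> [sqf|eW].
  by have [] := wilcoxon_efficiencies hdens hmodel hN hlambda hlambda01 intk k1
    hh_gt0 hh_to0 sqf.
have sqf : lebesgue_measure.-integrable setT (EFin \o (fun x => f x ^+ 2)).
  apply: (sqr_integrable_of_derivable hdens hmodel).
  exact: (derivable_of_wilcoxon hdens hmodel hN hlambda hlambda01 eW).
by have [] := wilcoxon_efficiencies hdens hmodel hN hlambda hlambda01 intk k1
    hh_gt0 hh_to0 sqf.
Qed.
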